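(* (1) Let $\mathbb K$ be a first-order structure, let $d$ be a dimension function on $\mathbb K$, and let $\mathbb M\succeq\mathbb K$ be a monster model of the theory of $\mathbb K$. Then (the extension to $\mathbb M$ of) $\mathrm{cl}^d$ is an existential matroid on $\mathbb M$ with definable dimension, and the dimension induced by $\mathrm{cl}^d$ is precisely $d$. (2) Conversely, if $\mathrm{cl}$ is an existential matroid with definable dimension on a monster model $\mathbb M$, then $\dim^{\mathrm{cl}}$ is a dimension function on $\mathbb M$, and $\mathrm{cl}^{\dim^{\mathrm{cl}}}=\mathrm{cl}$.
   Context: Dimension functions. A dimension function on a structure $\mathbb K$ is a function $d$ from the sets definable in $\mathbb K$ (with parameters, in any $\mathbb K^m$) to $\{-\infty\}\cup\mathbb N$ such that for all $m$ and all definable $S,S_1,S_2\subseteq\mathbb K^m$: (Dim 1) $d(S)=-\infty$ iff $S=\emptyset$; $d(\{a\})=0$ for every $a\in\mathbb K$; $d(\mathbb K)=1$. (Dim 2) $d(S_1\cup S_2)=\max(d(S_1),d(S_2))$. (Dim 3) $d(S^\sigma)=d(S)$ for every permutation $\sigma$ of the coordinates of $\mathbb K^m$. (Dim 4) If $U\subseteq\mathbb K^{m+1}$ is definable and, for $i=0,1$, $U(i):=\{x\in\mathbb K^m: d(U_x)=i\}$ where $U_x=\{t\in\mathbb K:(x,t)\in U\}$, then $U(i)$ is definable with the same parameters as $U$, and $d(U\cap\pi^{-1}(U(i)))=d(U(i))+i$ for $i=0,1$, where $\pi:\mathbb K^{m+1}\to\mathbb K^m$ is the projection onto the first $m$ coordinates.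 For $A\subset\mathbb K$ and $b\in\mathbb K$, set $b\in\mathrm{cl}^d(A)$ iff there is $X\subseteq\mathbb K$ definable with parameters in $A$ such that $d(X)=0$ and $b\in X$. The function $d$ extends to $\mathbb M\succeq\mathbb K$: for a formula $\phi(\bar x,\bar y)$ without parameters and $k\in\mathbb N$, (Dim 4) yields a formula $\psi_k(\bar y)$ without parameters defining $\{\bar y: d(\phi(\mathbb K,\bar y))=k\}$ in $\mathbb K$, and one sets $d(\phi(\mathbb M,\bar b))=k$ iff $\mathbb M\models\psi_k(\bar b)$; $\mathrm{cl}^d$ on $\mathbb M$ is defined from this extended $d$ by the same formula. Matroids. A monster model $\mathbb M$ of a complete theory $T$ is a $\kappa$-saturated, strongly $\kappa$-homogeneous model, $\kappa>|T|$ large; ''small'' means of cardinality $<\kappa$. A (finitary) matroid on $\mathbb M$ is an operator $\mathrm{cl}:\mathcal P(\mathbb M)\to\mathcal P(\mathbb M)$ with: $X\subseteq \mathrm{cl}(X)$; $X\subseteq Y\Rightarrow \mathrm{cl}(X)\subseteq \mathrm{cl}(Y)$; $\mathrm{cl}(\mathrm{cl}(X))=\mathrm{cl}(X)$; $\mathrm{cl}(X)=\bigcup\{\mathrm{cl}(A): A\subseteq X \text{ finite}\}$; and exchange: $a\in \mathrm{cl}(X\cup\{c\})\setminus \mathrm{cl}(X)$ implies $c\in\mathrm{cl}(X\cup\{a\})$. A formula $\phi(x,\bar y)$ without parameters, $x$ a single variable, is $x$-narrow if for all $a,\bar b$, $\mathbb M\models\phi(a,\bar b)$ implies $a\in\mathrm{cl}(\bar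 b)$. The matroid is definable if for every $A$, $\mathrm{cl}(A)$ is the union of the sets $\phi(\mathbb M,\bar a)$ with $\phi$ $x$-narrow and $\bar a$ a finite tuple from $A$. It satisfies Existence if for every element $a$ and all small $B,C$ with $a\notin\mathrm{cl}(B)$ there is $a'$ with the same type as $a$ over $B$ and $a'\notin\mathrm{cl}(B\cup C)$. The trivial matroid is $\mathrm{cl}^0(X)=\mathbb M$ for all $X$. An existential matroid is a definable matroid that satisfies Existence and is not trivial. $\mathrm{rk}^{\mathrm{cl}}(\bar b/A)$ is the cardinality of a maximal subtuple of $\bar b$ that is $\mathrm{cl}$-independent over $A$. For $V\subseteq\mathbb M^n$ definable over a small $A$, $\dim^{\mathrm{cl}}(V)=\max\{\mathrm{rk}^{\mathrm{cl}}(\bar b/A):\bar b\in V\}$, with $\dim^{\mathrm{cl}}(\emptyset)=-\infty$ (independent of $A$); this is the dimension induced by $\mathrm{cl}$. The dimension is definable if for every definable $X\subseteq\mathbb M^m\times\mathbb M^n$ and every $e$, the set $\{\bar a\in\mathbb M^m:\dim^{\mathrm{cl}}(X_{\bar a})=e\}$ is definable. *)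

(* Defs.v *)
From mathcomp Require Import all_boot perm.
From mathcomp Require Import boolp classical_sets functions cardinality.

Set Implicit Arguments.
Unset Strict Implicit.
Unset Printing Implicit Defensive.

Local Open Scope classical_set_scope.
Local Open Scope card_scope.

(* Formulas are well scoped: [formula L n] has its free variables in ['I_n],
   and a point of [M^n] is a function ['I_n -> M].  A formula phi(x, y) with
   |x| = m and |y| = n is an element of [formula L (m + n)]. *)

Record language := Language {
  fsym : Type;
  fsym_arity : fsym -> nat;
  rsym : Type;
  rsym_arity : rsym -> nat }.

Inductive term (L : language) (n : nat) : Type :=
| Var of 'I_n
| App (f : fsym L) of ('I_(fsym_arity f) -> term L n).

Inductive formula (L : language) (n : nat) : Type :=
| Fls
| Equ of term L n & term L n
| Rel (r : rsym L) of ('I_(rsym_arity r) -> term L n)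
| Imp of formula L n & formula L n
| All of formula L (n + 1).

Record structure (L : language) := Structure {
  carrier :> Type;
  fsym_interp : forall f : fsym L, ('I_(fsym_arity f) -> carrier) -> carrier;
  rsym_interp : forall r : rsym L, ('I_(rsym_arity r) -> carrier) -> Prop }.

Definition join (M : Type) m n (x : 'I_m -> M) (y : 'I_n -> M) :
  'I_(m + n) -> M :=
  fun i => match fintype.split i with inl k => x k | inr k => y k end.

(* an element of M, seen as a point of M^1 *)
Definition pt (M : Type) (a : M) : 'I_1 -> M := fun=> a.

Fixpoint eval L (M : structure L) n (v : 'I_n -> M) (t : term L n) : M :=
  match t with
  | Var i => v i
  | App f ts => fsym_interp (fun k => eval v (ts k))
  end.

Fixpoint sat L (M : structure L) n (phi : formula L n) : ('I_n -> M) -> Prop :=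
  match phi with
  | Fls => fun=> False
  | Equ s t => fun v => eval v s = eval v t
  | Rel r ts => fun v => rsym_interp (fun k => eval v (ts k))
  | Imp p q => fun v => sat p v -> sat q v
  | All p => fun v => forall a : M, sat p (join v (pt a))
  end.

Definition theory L (M : structure L) : set (formula L 0) :=
  [set phi | forall v : 'I_0 -> M, sat phi v].

Definition elementary L (K M : structure L) (j : K -> M) : Prop :=
  forall n (phi : formula L n) (v : 'I_n -> K), sat phi v <-> sat phi (j \o v).

Definition solset L (M : structure L) m n (phi : formula L (m + n))
  (b : 'I_n -> M) : set ('I_m -> M) := [set x | sat phi (join x b)].

Record pformula L (M : structure L) (m : nat) := PFormula {
  pf_arity : nat;
  pf_formula : formula L (m + pf_arity);
  pf_params : 'I_pf_arity -> M }.

Definition psol L (M : structure L) m (th : pformula M m) : set ('I_m -> M) :=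
  solset (pf_formula th) (@pf_params _ _ _ th).

Definition params_in L (M : structure L) m (A : set M) (th : pformula M m) :=
  forall i, A (@pf_params _ _ _ th i).

Definition definable_over L (M : structure L) (A : set M) m
  (S : set ('I_m -> M)) : Prop :=
  exists th : pformula M m, params_in A th /\ S = psol th.

Definition definable L (M : structure L) m (S : set ('I_m -> M)) : Prop :=
  definable_over [set: M] S.

(* The cardinal kappa is represented by a type of that cardinality. *)

Definition small (kappa T : Type) (A : set T) : Prop :=
  A #<= [set: kappa] /\ ~ ([set: kappa] #<= A).

Definition saturated (kappa : Type) L (M : structure L) : Prop :=
  forall A : set M, small kappa A ->
  forall p : set (pformula M 1), (forall th, p th -> params_in A th) ->
  (forall q, q `<=` p -> finite_set q ->
     exists a : M, forall th, q th -> psol th (pt a)) ->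
  exists a : M, forall th, p th -> psol th (pt a).

Definition elementary_on L (M : structure L) (A : set M) (f : M -> M) : Prop :=
  forall n (phi : formula L n) (v : 'I_n -> M), (forall i, A (v i)) ->
  (sat phi v <-> sat phi (f \o v)).

Definition automorphism L (M : structure L) (s : M -> M) : Prop :=
  [/\ bijective s,
      forall (f : fsym L) v, s (fsym_interp (f := f) v)
                             = fsym_interp (f := f) (s \o v)
    & forall (r : rsym L) (v : 'I_(rsym_arity r) -> M),
        rsym_interp v <-> rsym_interp (s \o v)].

Definition strongly_homogeneous (kappa : Type) L (M : structure L) : Prop :=
  forall (A : set M) (f : M -> M), small kappa A -> elementary_on A f ->
  exists s : M -> M, automorphism s /\ (forall a, A a -> s a = f a).

(* [theory M] is the complete theory T of which M is a monster model, so the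
   first clause is |T| < kappa. *)
Definition monster (kappa : Type) L (M : structure L) : Prop :=
  [/\ small kappa (theory M), saturated kappa M
    & strongly_homogeneous kappa M].

(* [None] is -oo.  A dimension function is a total function on sets of which
   only the values at definable sets are relevant. *)

Definition dimval := option nat.

Definition dmax (d e : dimval) : dimval :=
  match d, e with
  | Some k, Some l => Some (maxn k l)
  | None, _ => e
  | _, None => d
  end.

Definition dimfun (M : Type) := forall m, set ('I_m -> M) -> dimval.

Definition fiber (M : Type) m n (X : set ('I_(m + n) -> M)) (x : 'I_m -> M) :
  set ('I_n -> M) := [set y | X (join x y)].

Definition proj (M : Type) m n (z : 'I_(m + n) -> M) : 'I_m -> M :=
  z \o @lshift m n.

Definition level (M : Type) (d : dimfun M) m (U : set ('I_(m + 1) -> M))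
  (i : nat) : set ('I_m -> M) := [set x | d 1 (fiber U x) = Some i].

Record is_dimension L (M : structure L) (d : dimfun M) : Prop := IsDimension {
  dim1_empty : forall m (S : set ('I_m -> M)), definable S ->
    (d m S = None <-> S = set0);
  dim1_point : forall a : M, d 1 [set pt a] = Some 0;
  dim1_line : d 1 setT = Some 1;
  dim2 : forall m (S1 S2 : set ('I_m -> M)), definable S1 -> definable S2 ->
    d m (S1 `|` S2) = dmax (d m S1) (d m S2);
  dim3 : forall m (S : set ('I_m -> M)) (s : {perm 'I_m}), definable S ->
    d m [set x \o s | x in S] = d m S;
  dim4_definable : forall m (U : set ('I_(m + 1) -> M)) (A : set M) (i : nat),
    definable_over A U -> i <= 1 -> definable_over A (level d U i);
  dim4_add : forall m (U : set ('I_(m + 1) -> M)) (i : nat),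
    definable U -> i <= 1 ->
    d (m + 1) (U `&` [set z | level d U i (proj z)])
    = omap (addn ^~ i) (d m (level d U i)) }.

Definition cl_dim L (M : structure L) (d : dimfun M) (A : set M) : set M :=
  [set b | exists X : set ('I_1 -> M),
             [/\ definable_over A X, d 1 X = Some 0 & X (pt b)]].

(* The extension of d from K to an elementary extension M: the value at
   phi(M, b) is k when b satisfies a parameter-free formula psi defining
   { y | d (phi(K, y)) = k } in K, and -oo when there is no such k. *)
Definition dim_ext L (K M : structure L) (d : dimfun K) : dimfun M :=
  fun m V => xget None
    [set e | exists k : nat, e = Some k /\
       exists n (phi : formula L (m + n)) (psi : formula L n) (b : 'I_n -> M),
       [/\ V = solset phi b,
           forall y : 'I_n -> K, sat psi y <-> d m (solset phi y) = Some k
         & sat psi b]].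
Arguments dim_ext {L K} M d {m} V.

Record is_matroid (M : Type) (cl : set M -> set M) : Prop := IsMatroid {
  cl_extensive : forall X, X `<=` cl X;
  cl_monotone : forall X Y, X `<=` Y -> cl X `<=` cl Y;
  cl_idempotent : forall X, cl (cl X) = cl X;
  cl_finitary : forall X,
    cl X = \bigcup_(A in [set A | finite_set A /\ A `<=` X]) cl A;
  cl_exchange : forall X a c,
    cl (X `|` [set c]) a -> ~ cl X a -> cl (X `|` [set a]) c }.

Definition narrow L (M : structure L) (cl : set M -> set M) n
  (phi : formula L (1 + n)) : Prop :=
  forall (a : M) (b : 'I_n -> M), sat phi (join (pt a) b) -> cl (range b) a.

Definition definable_matroid L (M : structure L) (cl : set M -> set M) : Prop :=
  forall A : set M,
    cl A = [set a | exists n (phi : formula L (1 + n)) (b : 'I_n -> M),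
              [/\ narrow cl phi, (forall i, A (b i)) & solset phi b (pt a)]].

Definition same_type L (M : structure L) (B : set M) (a a' : M) : Prop :=
  forall th : pformula M 1, params_in B th ->
  (psol th (pt a) <-> psol th (pt a')).

Definition existence (kappa : Type) L (M : structure L)
  (cl : set M -> set M) : Prop :=
  forall (a : M) (B C : set M), small kappa B -> small kappa C -> ~ cl B a ->
  exists a' : M, same_type B a a' /\ ~ cl (B `|` C) a'.

Record existential_matroid (kappa : Type) L (M : structure L)
    (cl : set M -> set M) : Prop := ExistentialMatroid {
  em_matroid : is_matroid cl;
  em_definable : definable_matroid cl;
  em_existence : existence kappa cl;
  em_nontrivial : ~ (forall X, cl X = [set: M]) }.

Definition indep (M : Type) (cl : set M -> set M) n (b : 'I_n -> M)
  (A : set M) (I : {set 'I_n}) : Prop :=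
  forall i, i \in I ->
    ~ cl (A `|` [set b k | k in [set k | k \in I /\ k != i]]) (b i).

(* All inclusion-maximal independent subtuples have the same cardinality when
   cl is a matroid. *)
Definition rk (M : Type) (cl : set M -> set M) n (b : 'I_n -> M)
  (A : set M) : nat :=
  \max_(I : {set 'I_n} | maxset (fun I => `[< indep cl b A I >]) I) #|I|.

Definition dim_over (M : Type) (cl : set M -> set M) (A : set M) n
  (V : set ('I_n -> M)) : dimval :=
  if `[< V = set0 >] then None
  else Some (\max_(k < n.+1 | `[< exists2 b, V b & rk cl b A = k >]) k).

(* The small set A over which V is definable is picked by choice; for an
   existential matroid the value does not depend on it. *)
Definition dim_cl (kappa : Type) L (M : structure L) (cl : set M -> set M) :
  dimfun M :=
  fun m V =>
    dim_over cl (xget set0 [set A | small kappa A /\ definable_over A V]) V.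
Arguments dim_cl kappa {L M} cl {m} V.

Definition definable_dimension (kappa : Type) L (M : structure L)
  (cl : set M -> set M) : Prop :=
  forall m n (X : set ('I_(m + n) -> M)) (e : dimval), definable X ->
  definable [set a | dim_cl kappa cl (fiber X a) = e].

(* Main.v *)
(* A dimension function satisfies d(U) = max(d(U(0)), d(U(1)) + 1), where U(i) is
   the set of base points over which the fiber of U in the last coordinate has
   dimension i.  Hence d is determined by its values on subsets of the line, and
   by induction on m the condition d(phi(K, y)) = e on y is given by a formula
   without parameters, so that the clauses (Dim 1-4) transfer to M.

   On M, exchange and idempotence of cl^d come from computing the dimension of a
   subset of the plane along either coordinate, and Existence from saturation,
   since no set of dimension 1 is covered by finitely many of dimension 0.

   The rank is additive, rk(b, t / A) = rk(b / A) + [t not in cl(A, b)], and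
   points generic over a small set exist, so dim^cl computed over A obeys the same
   recursion.  This gives dim^cl = d in part (1).  In part (2), Existence shows that
   the dimension of a subset of the line does not depend on A, and compactness that
   the U(i) are definable over the parameters of U; the recursion then yields the
   independence of A in all arities. *)
Require Import Defs.
From mathcomp Require Import all_boot perm.
From mathcomp Require Import boolp classical_sets functions cardinality.

Set Implicit Arguments.
Unset Strict Implicit.
Unset Printing Implicit Defensive.

Local Open Scope classical_set_scope.
Local Open Scope card_scope.

(** * Small sets *)

(** Injections are handled as relations, so that no caller has to define a function on the whole
    type; [choice] extracts one here, with the default value [y0] outside [A]. *)
Lemma card_le_rel T U (A : set T) (B : set U) (R : T -> U -> Prop) :
  (forall x, A x -> exists2 y, B y & R x y) ->
  (forall x x' y, A x -> A x' -> R x y -> R x' y -> x = x') -> A #<= B.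
Proof.
move=> tot inj; have [->|/set0P[x0 Ax0]] := eqVneq A set0; first exact: card_ge0.
have [y0 _ _] := tot _ Ax0.
have /choice[f fP] : forall x, exists y, A x -> B y /\ R x y.
  move=> x; have [/tot[y By Rxy]|nAx] := pselect (A x).
    by exists y.
  by exists y0.
have finj : {in A &, injective f}.
  move=> x x'; rewrite !inE => Ax Ax' e; apply: (inj x x' (f x)) => //.
    exact: (fP x Ax).2.
  by rewrite e; exact: (fP x' Ax').2.
rewrite -(card_le_eql (inj_card_eq finj)); apply: subset_card_le.
by move=> _ [x Ax <-]; exact: (fP x Ax).1.
Qed.

Lemma card_leE T U (A : set T) (B : set U) : A #<= B ->
  exists R : T -> U -> Prop, (forall x, A x -> exists2 y, B y & R x y) /\
  (forall x x' y, A x -> A x' -> R x y -> R x' y -> x = x').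
Proof.
move=> /card_leP[f]; exists (fun x y => exists Ax : x \in A, y = val (f (SigSub Ax))).
split=> [x Ax|x x' y Ax Ax' [a ->] [a' e]].
  have a : x \in A by rewrite inE.
  by exists (val (f (SigSub a))); [exact: set_valP|exists a].
have := val_inj e => /(@inj _ _ _ f).
by rewrite !inE => /(_ I I) [].
Qed.

(** Zorn's lemma gives a maximal partial injection from [A] to [B]. It is total on [A] or onto [B],
    since otherwise one more pair could be added. *)
Lemma card_le_total T U (A : set T) (B : set U) : A #<= B \/ B #<= A.
Proof.
pose P (R : set (T * U)) := (forall z, R z -> A z.1 /\ B z.2) /\
  (forall z z', R z -> R z' -> z.1 = z'.1 \/ z.2 = z'.2 -> z = z').
have [F FP Ftot|R [PR Rmax]] := @Zorn_bigcup _ P.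
  split=> [z [R FR Rz]|z z' [R FR Rz] [R' FR' Rz']].
    exact: ((FP _ FR).1 z).
  have [RR'|R'R] := Ftot _ _ FR FR'.
    exact: (FP _ FR').2 (RR' _ Rz) Rz'.
  exact: (FP _ FR).2 Rz (R'R _ Rz').
have [domA|/existsNP[x /not_implyP[Ax xR]]] :=
    pselect (forall x, A x -> exists y, R (x, y)).
  left; apply: (@card_le_rel _ _ _ _ (fun x y => R (x, y))) => [x /domA[y Rxy]|].
    by exists y => //; exact: (PR.1 _ Rxy).2.
  by move=> x x' y _ _ r r'; have [] := PR.2 _ _ r r' (or_intror erefl).
have [ranB|/existsNP[y /not_implyP[By yR]]] :=
    pselect (forall y, B y -> exists x, R (x, y)).
  right; apply: (@card_le_rel _ _ _ _ (fun y x => R (x, y))) => [y /ranB[x' Rxy]|].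
    by exists x' => //; exact: (PR.1 _ Rxy).1.
  by move=> y y' x' _ _ r r'; have [] := PR.2 _ _ r r' (or_introl erefl).
exfalso; apply: (Rmax (R `|` [set (x, y)])).
  split; first exact: subsetUl.
  by move=> /(_ (x, y)) /= h; apply: xR; exists y; apply: h; right.
split=> [z [/PR.1 //|->//]|z z' [Rz|->] [Rz'|->]] //=.
- exact: PR.2.
- case: z Rz => u v Rz /= [] e; [case: xR; exists v|case: yR; exists u].
    by rewrite -e.
  by rewrite -e.
- case: z' Rz' => u v Rz /= [] e; [case: xR; exists v|case: yR; exists u].
    by rewrite e.
  by rewrite e.
Qed.

(* By Zorn, take a maximal injection [bool * Y -> Y] with [Y] inside [A]; what
   is left of [A] is finite, since a countable part could be added to [Y]. *)
Lemma infinite_card_double T (A : set T) : infinite_set A ->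
  [set: bool] `*` A #<= A.
Proof.
move=> Ainf.
pose dom (R : set (bool * T * T)) := [set t | exists s, R (true, t, s)].
pose P (R : set (bool * T * T)) :=
  (forall b t s, R (b, t, s) ->
     [/\ A t, A s, forall b', exists s', R (b', t, s') & dom R s]) /\
  (forall x x' s, R (x, s) -> R (x', s) -> x = x').
have [F FP Ftot|R [PR Rmax]] := @Zorn_bigcup _ P.
  split=> [b t s [R FR Rz]|x x' s [R FR Rz] [R' FR' Rz']].
    have [At As tot [s' Rs]] := (FP _ FR).1 _ _ _ Rz.
    split=> // [b'|]; last by exists s'; exists R.
    by have [s1 ?] := tot b'; exists s1; exists R.
  have [RR'|R'R] := Ftot _ _ FR FR'.
    exact: (FP _ FR').2 (RR' _ Rz) Rz'.
  exact: (FP _ FR).2 Rz (R'R _ Rz').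
pose Y := dom R.
have YA : Y `<=` A by move=> t [s /PR.1[]].
have YY : [set: bool] `*` Y #<= Y.
  apply: (@card_le_rel _ _ _ _ (fun x s => R (x, s))) => [[b t] /= [_ [s Rts]]|x x' s _ _].
    have [_ _ /(_ b)[s' Rs'] _] := PR.1 _ _ _ Rts.
    by exists s' => //; have [] := PR.1 _ _ _ Rs'.
  exact: PR.2.
have AYfin : finite_set (A `\` Y).
  apply: contrapT => /infiniteP /card_leE[e0 [e0tot e0inj]].
  have /choice[e eP] : forall n, exists y, (A `\` Y) y /\ e0 n y.
    by move=> n; have [y Dy ey] := e0tot n I; exists y.
  have einj n n' : e n = e n' -> n = n'.
    move=> en; apply: (e0inj n n' (e n)) => //; first exact: (eP n).2.
    by rewrite en; exact: (eP n').2.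
  (* The pair [(b, n)] is coded by [b + n.*2] and decoded below with [odd] and [half], so that the
     range of [e] carries its own doubling, disjoint from that of [R]. *)
  pose R' := R `|` [set z | exists (b : bool) n, z = (b, e n, e (b + n.*2))].
  have inR' (b : bool) n : R' (b, e n, e (b + n.*2)) by right; exists b, n.
  have domR' n : dom R' (e n) by exists (e (true + n.*2)); apply: inR'.
  apply: (Rmax R').
    split; first exact: subsetUl.
    move=> /(_ _ (inR' true 0)) R0; have [_] := (eP 0).1; apply.
    by exists (e (true + 0.*2)).
  split=> [b t s [Rts|[b' [n [_ -> ->]]]]|x x' s].
  - have [At As tot [s' Rs]] := PR.1 _ _ _ Rts.
    split=> // [b'|]; last by exists s'; left.
    by have [s1 ?] := tot b'; exists s1; left.
  - split=> //; first exact: (eP _).1.1.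
      exact: (eP _).1.1.
    by move=> b1; exists (e (b1 + n.*2)).
  - move=> [Rxs|[b [n [-> es]]]] [Rxs'|[b' [n' [-> es']]]].
    + exact: PR.2 Rxs Rxs'.
    + have [_] := (eP (b' + n'.*2)).1; case; rewrite -es'.
      by case: x Rxs => c t /PR.1[].
    + have [_] := (eP (b + n.*2)).1; case; rewrite -es.
      by case: x' Rxs' => c t /PR.1[].
    + have /einj h : e (b + n.*2) = e (b' + n'.*2) by rewrite -es es'.
      have := congr1 odd h; rewrite !oddD !odd_double !addbF !oddb => <-.
      have := congr1 half h; rewrite !half_bit_double => ->.
      by [].
have Yinf : infinite_set Y.
  move=> Yfin; apply: Ainf; apply: (@sub_finite_set _ _ (Y `|` (A `\` Y))).
    by move=> t At; have [|] := pselect (Y t); [left|right].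
  by rewrite finite_setU.
have /card_leE[g [gtot ginj]] : (A `\` Y) #<= Y.
  apply: (@card_le_trans _ _ _ [set: nat]); first exact: finite_set_countable.
  exact/infiniteP.
have AY : A #<= Y.
  apply: card_le_trans YY.
  apply: (@card_le_rel _ _ _ _ (fun x z => if z.1 then Y x /\ z.2 = x
                                 else ~ Y x /\ g x z.2)) => [t At|].
    have [Yt|nYt] := pselect (Y t); first by exists (true, t).
    by have [y Yy gy] := gtot t (conj At nYt); exists (false, y).
  move=> x x' [[] y] /= Ax Ax'; first by move=> [_ ->] [_ ->].
  by move=> [nx gx] [nx' gx']; apply: (ginj x x' y).
have AYT : A #<= Y -> [set: bool] `*` A #<= [set: bool] `*` Y.
  move=> /card_leE[f [ftot finj]].
  apply: (@card_le_rel _ _ _ _ (fun x z => x.1 = z.1 /\ f x.2 z.2)).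
    by move=> [b t] /= [_ /ftot[y Yy fy]]; exists (b, y).
  move=> [b t] [b' t'] [c y] /= [_ At] [_ At'] [-> fy] [-> fy'].
  by rewrite (finj t t' y).
exact: (card_le_trans (AYT AY)) (card_le_trans YY (subset_card_le YA)).
Qed.

(** A boolean tag separates [C] from the rest of [B], which embeds the union into two copies of
    [C]. *)
Lemma card_setU_le T (B C : set T) : infinite_set C -> B #<= C -> B `|` C #<= C.
Proof.
move=> Cinf /card_leE[f [ftot finj]];
  apply: card_le_trans (infinite_card_double Cinf).
apply: (@card_le_rel _ _ _ _ (fun x z => if z.1 then C x /\ z.2 = x
                                 else B x /\ f x z.2)) => [t BCt|].
  have [Ct|nCt] := pselect (C t); first by exists (true, t).
  by case: BCt => // Bt; have [y Yy gy] := ftot t Bt; exists (false, y).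
move=> x x' [[] y] /= Ax Ax'; first by move=> [_ ->] [_ ->].
by move=> [nx gx] [nx' gx']; apply: (finj x x' y).
Qed.

Section Small.
Variable kappa : Type.
Hypothesis kinf : infinite_set [set: kappa].

Lemma small_finite T (A : set T) : finite_set A -> small kappa A.
Proof.
move=> Af; split.
  apply: (@card_le_trans _ _ _ [set: nat]); first exact: finite_set_countable.
  exact/infiniteP.
by move=> /card_le_finite /(_ Af).
Qed.

Lemma smallU T (A B : set T) : small kappa A -> small kappa B ->
  small kappa (A `|` B).
Proof.
wlog AB : A B / A #<= B => [h sA sB|].
  by have [/h|/h] := card_le_total A B; [|rewrite setUC]; apply.
move=> sA sB; have [Bf|Binf] := pselect (finite_set B).
  by apply: small_finite; rewrite finite_setU; split=> //;
    exact: card_le_finite AB Bf.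
have UB := card_setU_le Binf AB.
split; first exact: card_le_trans UB sB.1.
by move=> /card_le_trans /(_ UB) /sB.2.
Qed.

End Small.

(** Even over an empty language the theory is infinite: the nested implications [f n] are pairwise
    distinct valid sentences. *)
Lemma monster_infinite kappa L (M : structure L) : monster kappa M ->
  infinite_set [set: kappa].
Proof.
move=> [[tk _] _ _] /(card_le_finite tk) tfin.
pose f n : formula L 0 := iter n (Imp (Fls L 0)) (Imp (Fls L 0) (Fls L 0)).
suff : finite_set [set: nat] by apply: infinite_nat.
apply: (@card_le_finite _ _ [set: nat] _ _ tfin).
apply: (@card_le_rel _ _ _ _ (fun n p => p = f n)) => [n _|n n' _ _ _ -> ].
  by exists (f n) => // v; case: n => /=.
by elim: n n' => [|n IH] [|n'] //=; [case: n'|case: n {IH}|move=> [] /IH->].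
Qed.

(** * Points and formulas *)

Section Points.
Variable M : Type.

Lemma join_lshift m n (x : 'I_m -> M) (y : 'I_n -> M) : join x y \o @lshift m n = x.
Proof. by apply: funext => i; rewrite /join /= (unsplitK (inl i)). Qed.

Lemma join_rshift m n (x : 'I_m -> M) (y : 'I_n -> M) : join x y \o @rshift m n = y.
Proof. by apply: funext => i; rewrite /join /= (unsplitK (inr i)). Qed.

Lemma joinl m n (x : 'I_m -> M) (y : 'I_n -> M) i : join x y (lshift n i) = x i.
Proof. by rewrite -[x in RHS](join_lshift x y). Qed.

Lemma joinr m n (x : 'I_m -> M) (y : 'I_n -> M) i : join x y (rshift m i) = y i.
Proof. by rewrite -[y in RHS](join_rshift x y). Qed.

Lemma join_comp (N : Type) (f : M -> N) m n (x : 'I_m -> M) (y : 'I_n -> M) :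
  f \o join x y = join (f \o x) (f \o y).
Proof. by apply: funext => i; rewrite /join /=; case: fintype.split. Qed.

Lemma join_proj m n (z : 'I_(m + n) -> M) : join (z \o @lshift m n) (z \o @rshift m n) = z.
Proof.
by apply: funext => i; rewrite /join /= -[in RHS](splitK i); case: fintype.split.
Qed.

Lemma proj_join m n (x : 'I_m -> M) (y : 'I_n -> M) : proj (join x y) = x.
Proof. exact: join_lshift. Qed.

Lemma pt_ord0 (x : 'I_1 -> M) : pt (x ord0) = x.
Proof. by apply: funext => i; rewrite /pt (ord1 i). Qed.

Lemma joinP m n (z : 'I_(m + n) -> M) : exists x y, z = join x y.
Proof. by exists (z \o @lshift m n), (z \o @rshift m n); rewrite join_proj. Qed.

Lemma join1P m (z : 'I_(m + 1) -> M) : exists x t, z = join x (pt t).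
Proof. by have [x [y ->]] := joinP z; exists x, (y ord0); rewrite pt_ord0. Qed.

Definition pt0 : 'I_0 -> M := fun i => match notF (ltn_ord i) with end.

Lemma pt0_unique (x y : 'I_0 -> M) : x = y.
Proof. by apply: funext => -[]. Qed.

Lemma join0l n (x : 'I_0 -> M) (y : 'I_n -> M) : join x y = y.
Proof.
apply: funext => i; rewrite -[in RHS](joinr x y); congr join.
exact: val_inj.
Qed.

Lemma range_join m n (x : 'I_m -> M) (y : 'I_n -> M) :
  range (join x y) = range x `|` range y.
Proof.
apply/seteqP; split=> [_ [i _ <-]|_ [] [i _ <-]].
- by rewrite /join; case: fintype.split => k; [left|right]; exists k.
- by exists (lshift n i); rewrite ?joinl.
- by exists (rshift m i); rewrite ?joinr.
Qed.

Lemma range_sub_comp m n (x : 'I_m -> M) (y : 'I_n -> M) :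
  range x `<=` range y -> exists f, x = y \o f.
Proof.
move=> xy; have /choice[f fP] : forall i, exists j, y j = x i.
  by move=> i; have [j _ ?] := xy (x i) (ex_intro2 _ _ i I erefl); exists j.
by exists f; apply: funext => i /=.
Qed.

End Points.

(** * Renaming of variables and derived connectives *)

Section Formulas.
Variable L : language.

Fixpoint rename_term n p (f : 'I_n -> 'I_p) (t : term L n) : term L p :=
  match t with
  | Var i => Var L (f i)
  | App g ts => App (fun k => rename_term f (ts k))
  end.

Fixpoint rename n (phi : formula L n) : forall p, ('I_n -> 'I_p) -> formula L p :=
  match phi with
  | Fls => fun p _ => Fls L p
  | Equ s t => fun p f => Equ (rename_term f s) (rename_term f t)
  | Rel r ts => fun p f => Rel (fun k => rename_term f (ts k))
  | Imp a b => fun p f => Imp (rename a f) (rename b f)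
  | All a => fun p f => All (rename a (join (@lshift p 1 \o f) (@rshift p 1)))
  end.

Lemma eval_rename (M : structure L) n p (f : 'I_n -> 'I_p) (v : 'I_p -> M) t :
  eval v (rename_term f t) = eval (v \o f) t.
Proof.
by elim: t => [i|g ts IH] //=; congr fsym_interp; apply: funext => k.
Qed.

Lemma sat_rename (M : structure L) n (phi : formula L n) p (f : 'I_n -> 'I_p)
    (v : 'I_p -> M) : sat (rename phi f) v <-> sat phi (v \o f).
Proof.
elim: phi p f v => [|{}n s t|{}n r ts|{}n a IHa b IHb|{}n a IH] p f v /=.
- by [].
- by rewrite !eval_rename.
- by under eq_fun do rewrite eval_rename.
- by rewrite IHa IHb.
- split=> h c; have := h c; rewrite IH join_comp compA join_lshift join_rshift //.
Qed.

Definition Neg n (a : formula L n) := Imp a (Fls L n).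
Definition Conj n (a b : formula L n) := Neg (Imp a (Neg b)).
Definition Disj n (a b : formula L n) := Imp (Neg a) b.
Definition Exi n (a : formula L (n + 1)) := Neg (All (Neg a)).

Variable M : structure L.

Lemma sat_neg n (a : formula L n) (v : 'I_n -> M) : sat (Neg a) v <-> ~ sat a v.
Proof. by []. Qed.

Lemma sat_conj n (a b : formula L n) (v : 'I_n -> M) :
  sat (Conj a b) v <-> sat a v /\ sat b v.
Proof.
rewrite /Conj /=; split=> [h|[ha hb] h]; last exact: h.
by split; apply: contrapT => nab; apply: h.
Qed.

Lemma sat_disj n (a b : formula L n) (v : 'I_n -> M) :
  sat (Disj a b) v <-> sat a v \/ sat b v.
Proof.
rewrite /Disj /=; split=> [h|[ha /(_ ha)//|//]].
by have [|/h] := pselect (sat a v); [left|right].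
Qed.

Lemma sat_exi n (a : formula L (n + 1)) (v : 'I_n -> M) :
  sat (Exi a) v <-> exists t, sat a (join v (pt t)).
Proof.
rewrite /Exi /=; split=> [|[t at_] h]; last exact: h at_.
by apply: contra_notP => /forallNP.
Qed.

End Formulas.

(** [elementary] speaks only of tuples coming from [K]. Closing the formula universally, one
    variable at a time, leads to a sentence, where every tuple of [M] is such a tuple. *)
Lemma elementary_valid L (K M : structure L) (j : K -> M) : elementary j ->
  forall n (a : formula L n), (forall v : 'I_n -> K, sat a v) ->
  forall v : 'I_n -> M, sat a v.
Proof.
move=> jel; elim=> [|n IH] a Ka v.
  by rewrite (pt0_unique v (j \o pt0 K)); apply/jel.
move: a Ka v; rewrite -addn1 => a Ka v; have [x [t ->]] := join1P v.
have /IH : forall u : 'I_n -> K, sat (All a) u by move=> u c; exact: Ka.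
exact.
Qed.

(** * Definable sets *)

Section Definability.
Variables (L : language) (M : structure L).

(* Definability over a fixed tuple [w]: unlike [definable_over], this puts
   finitely many definable sets over the same parameters. *)
Definition definable_by p (w : 'I_p -> M) n (S : set ('I_n -> M)) :=
  exists phi : formula L (n + p), S = [set x | sat phi (join x w)].

Lemma definable_overP (A : set M) n (S : set ('I_n -> M)) :
  definable_over A S <->
  exists p (w : 'I_p -> M), range w `<=` A /\ definable_by w S.
Proof.
split=> [[[p phi w] [wA ->]]|[p [w [wA [phi ->]]]]].
  exists p, w; split; first by move=> _ [i _ <-]; exact: wA.
  by exists phi.
exists (PFormula phi w); split=> // i; exact: (wA _ (imageP w I)).
Qed.

Lemma definable_by_range p (w : 'I_p -> M) n (S : set ('I_n -> M)) :
  definable_by w S -> definable_over (range w) S.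
Proof. by move=> wS; apply/definable_overP; exists p, w; split. Qed.

Lemma definable_by_sub p q (w : 'I_p -> M) (u : 'I_q -> M) n
  (S : set ('I_n -> M)) : range w `<=` range u -> definable_by w S -> definable_by u S.
Proof.
move=> /range_sub_comp[f ->] [phi ->].
exists (rename phi (join (@lshift n q) (@rshift n q \o f))).
apply: funext => x /=; apply/propext; rewrite sat_rename join_comp.
by rewrite join_lshift compA join_rshift.
Qed.

Lemma definable_over_sub (A B : set M) n (S : set ('I_n -> M)) :
  A `<=` B -> definable_over A S -> definable_over B S.
Proof.
move=> AB /definable_overP[p [w [wA wS]]]; apply/definable_overP.
by exists p, w; split=> // x /wA/AB.
Qed.

Lemma definable_over_definable (A : set M) n (S : set ('I_n -> M)) :
  definable_over A S -> definable S.
Proof. exact: definable_over_sub. Qed.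

Lemma definable_over_finite (A : set M) n (S : set ('I_n -> M)) :
  definable_over A S ->
  exists B, [/\ finite_set B, B `<=` A & definable_over B S].
Proof.
move=> /definable_overP[p [w [wA wS]]]; exists (range w); split=> //.
  exact: finite_image finite_finset.
exact: definable_by_range.
Qed.

Section FixedTuple.
Variables (p : nat) (w : 'I_p -> M).

Lemma definable_byC n (S : set ('I_n -> M)) : definable_by w S -> definable_by w (~` S).
Proof. by move=> [a ->]; exists (Neg a). Qed.

Lemma definable_byI n (S T : set ('I_n -> M)) : definable_by w S -> definable_by w T ->
  definable_by w (S `&` T).
Proof.
move=> [a ->] [b ->]; exists (Conj a b).
by apply: funext => x; apply/propext; rewrite /= -sat_conj.
Qed.

Lemma definable_byU n (S T : set ('I_n -> M)) : definable_by w S -> definable_by w T ->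
  definable_by w (S `|` T).
Proof.
move=> [a ->] [b ->]; exists (Disj a b).
by apply: funext => x; apply/propext; rewrite /= -sat_disj.
Qed.

Lemma definable_by_preimage m n (f : 'I_n -> 'I_m) (S : set ('I_n -> M)) :
  definable_by w S -> definable_by w [set x : 'I_m -> M | S (x \o f)].
Proof.
move=> [a ->]; exists (rename a (join (@lshift m p \o f) (@rshift m p))).
apply: funext => x; apply/propext; rewrite /= sat_rename join_comp compA.
by rewrite join_lshift join_rshift.
Qed.

Lemma definable_by_exists m (S : set ('I_(m + 1) -> M)) :
  definable_by w S -> definable_by w [set x | exists t, S (join x (pt t))].
Proof.
move=> [a ->].
pose f := join (join (@lshift (m + p) 1 \o @lshift m p) (@rshift (m + p) 1))
               (@lshift (m + p) 1 \o @rshift m p).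
exists (Exi (rename a f)); apply: funext => x; apply/propext; rewrite /mkset sat_exi.
suff h t : sat (rename a f) (join (join x w) (pt t)) <-> sat a (join (join x (pt t)) w).
  by split=> -[t /h]; exists t.
by rewrite sat_rename /f !join_comp !compA !join_lshift !join_rshift.
Qed.

Lemma definable_by_fiber m n (U : set ('I_(m + n) -> M)) x :
  definable_by w U -> definable_by (join x w) (fiber U x).
Proof.
move=> [a ->].
exists (rename a (join (join (@rshift n (m + p) \o @lshift m p) (@lshift n (m + p)))
               (@rshift n (m + p) \o @rshift m p))).
apply: funext => y; apply/propext; rewrite /fiber /= sat_rename.
by rewrite !join_comp !compA join_rshift !join_lshift join_rshift.
Qed.

Lemma definable_by_fiberE m n (x : 'I_m -> M) (S : set ('I_n -> M)) :
  definable_by (join x w) S -> exists2 U, definable_by w U & S = fiber U x.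
Proof.
move=> [a ->].
pose f := join (@lshift (m + n) p \o @rshift m n)
  (join (@lshift (m + n) p \o @lshift m n) (@rshift (m + n) p)).
exists [set z | sat (rename a f) (join z w)]; first by exists (rename a f).
apply: funext => y; apply/propext; rewrite /fiber /= sat_rename.
by rewrite !join_comp !compA !join_lshift !join_rshift.
Qed.

Lemma definable_by_set1 (i : 'I_p) : definable_by w [set pt (w i)].
Proof.
exists (Equ (Var L (lshift p ord0)) (Var L (rshift 1 i))).
apply: funext => x; apply/propext; rewrite /= joinl joinr; split=> [->//|e].
by rewrite -(pt_ord0 x) e.
Qed.

Lemma definable_byT n : definable_by w [set: 'I_n -> M].
Proof. by exists (Neg (Fls L _)); apply/seteqP; split=> x //= _. Qed.

End FixedTuple.

Lemma definable_over_common (A : set M) m n (S : set ('I_m -> M)) (T : set ('I_n -> M)) :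
  definable_over A S -> definable_over A T ->
  exists p (w : 'I_p -> M), [/\ range w `<=` A, definable_by w S & definable_by w T].
Proof.
move=> /definable_overP[p [w [wA wS]]] /definable_overP[q [u [uA uT]]].
exists (p + q), (join w u); split; first by rewrite range_join => x [/wA|/uA].
  by apply: definable_by_sub wS; rewrite range_join; exact: subsetUl.
by apply: definable_by_sub uT; rewrite range_join; exact: subsetUr.
Qed.

Lemma definable_overI (A : set M) n (S T : set ('I_n -> M)) :
  definable_over A S -> definable_over A T -> definable_over A (S `&` T).
Proof.
move=> hS hT; have [p [w [wA wS wT]]] := definable_over_common hS hT.
by apply/definable_overP; exists p, w; split=> //; exact: definable_byI.
Qed.

Lemma definable_overU (A : set M) n (S T : set ('I_n -> M)) :
  definable_over A S -> definable_over A T -> definable_over A (S `|` T).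
Proof.
move=> hS hT; have [p [w [wA wS wT]]] := definable_over_common hS hT.
by apply/definable_overP; exists p, w; split=> //; exact: definable_byU.
Qed.

Lemma definable_overC (A : set M) n (S : set ('I_n -> M)) :
  definable_over A S -> definable_over A (~` S).
Proof.
by move=> /definable_overP[p [w [wA wS]]]; apply/definable_overP; exists p, w;
  split=> //; exact: definable_byC.
Qed.

Lemma definable_overT (A : set M) n : definable_over A [set: 'I_n -> M].
Proof.
apply/definable_overP; exists 0, (pt0 M); split; first by move=> x [[]].
exact: definable_byT.
Qed.

Lemma definable_over0 (A : set M) n : definable_over A (set0 : set ('I_n -> M)).
Proof. by rewrite -setCT; apply: definable_overC; exact: definable_overT. Qed.

Lemma definable_over_set1 (A : set M) a : A a -> definable_over A [set pt a].
Proof.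
move=> Aa; apply/definable_overP; exists 1, (pt a).
by split; [move=> _ [i _ <-]|exact: (definable_by_set1 (pt a) ord0)].
Qed.

Lemma definable_over_preimage (A : set M) m n (f : 'I_n -> 'I_m) (S : set ('I_n -> M)) :
  definable_over A S -> definable_over A [set x : 'I_m -> M | S (x \o f)].
Proof.
by move=> /definable_overP[p [w [wA wS]]]; apply/definable_overP; exists p, w;
  split=> //; exact: definable_by_preimage.
Qed.

Lemma definable_over_exists (A : set M) m (S : set ('I_(m + 1) -> M)) :
  definable_over A S -> definable_over A [set x | exists t, S (join x (pt t))].
Proof.
by move=> /definable_overP[p [w [wA wS]]]; apply/definable_overP; exists p, w;
  split=> //; exact: definable_by_exists.
Qed.

Lemma definable_over_fiber (A : set M) m n (U : set ('I_(m + n) -> M)) x :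
  definable_over A U -> definable_over (A `|` range x) (fiber U x).
Proof.
move=> /definable_overP[p [w [wA wS]]]; apply/definable_overP;
  exists (m + p), (join x w).
by split; [rewrite range_join => z [|/wA]; [right|left]|exact: definable_by_fiber].
Qed.

(* A set defined with the extra parameter [c] is a fiber at [c]. *)
Lemma definable_over_setU1 (A : set M) c n (S : set ('I_n -> M)) :
  definable_over (A `|` [set c]) S ->
  exists2 U : set ('I_(1 + n) -> M), definable_over A U & S = fiber U (pt c).
Proof.
move=> /definable_overP[p [w [wA wS]]].
suff [q [u [uA wu]]] : exists q (u : 'I_q -> M),
    range u `<=` A /\ range w `<=` range (join (pt c) u).
  have [U Uu ->] := definable_by_fiberE (definable_by_sub wu wS).
  by exists U => //; apply/definable_overP; exists q, u.
(* The tuple [u] lists the entries of [w] that lie in [A]; every other entry equals [c]. *)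
exists #|[set i | `[< A (w i) >]]%SET|, (fun k => w (enum_val k)); split.
  by move=> _ [k _ <-]; have := enum_valP k; rewrite inE => /asboolP.
move=> _ [i _ <-]; rewrite range_join.
have [Ai|nAi] := pselect (A (w i)).
  right; have ii : i \in [set i | `[< A (w i) >]]%SET by rewrite inE; apply/asboolP.
  by exists (enum_rank_in ii i) => //; rewrite enum_rankK_in.
by left; have [//|->] := wA (w i) (ex_intro2 _ _ i I erefl); exists ord0.
Qed.

Lemma definable_over_empty n (S : set ('I_n -> M)) : definable_over set0 S <->
  exists phi : formula L n, S = [set x | sat phi x].
Proof.
split=> [/definable_overP[[|p] [w [w0 [phi ->]]]]|[phi ->]].
- have w0' := w0; exists (rename phi (cast_ord (addn0 n))).
  apply: funext => x; apply/propext; rewrite /= sat_rename.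
  suff -> : x \o cast_ord (addn0 n) = join x w by [].
  have [y [u e]] := joinP (x \o cast_ord (addn0 n)); rewrite e (pt0_unique u w).
  suff -> : x = y by [].
  apply: funext => i; rewrite -[y i](joinl y u) -e /=; congr x; exact: val_inj.
- by have := w0 (w ord0) (ex_intro2 _ _ ord0 I erefl).
apply/definable_overP; exists 0, (pt0 M); split; first by move=> x [[]].
exists (rename phi (@lshift n 0)); apply: funext => x; apply/propext.
by rewrite /= sat_rename join_lshift.
Qed.

End Definability.

(** * Saturation *)

(** A filter base, used in place of a partial type: finite satisfiability then reduces to each
    member being nonempty. *)
Definition directed T (F : set (set T)) :=
  F !=set0 /\ forall X Y, F X -> F Y -> exists2 Z, F Z & Z `<=` X `&` Y.

Lemma directed_finite T (F G : set (set T)) : directed F -> finite_set G -> G `<=` F ->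
  exists2 Z, F Z & forall X, G X -> Z `<=` X.
Proof.
move=> [[X0 FX0] FI] /finite_setP[n]; elim: n G => [|n IH] G.
  by rewrite II0 card_eq0 => /eqP -> _; exists X0.
move=> /eq_cardSP[X GX /IH{}IH] GF.
have [|Z FZ ZG] := IH; first by move=> Y [/GF].
have [W FW WZ] := FI _ _ FZ (GF _ GX); exists W => // Y GY.
have [->|YX] := pselect (Y = X); first by move=> x /WZ[].
by move=> x /WZ[/ZG h _]; exact: h.
Qed.

(** Saturation is assumed for one variable only. By induction the projections of the members of [F]
    have a common point [x], and the fibers over [x] form a consistent 1-type over [A] and the
    coordinates of [x]. *)
Lemma saturated_directed kappa L (M : structure L) n (A : set M)
    (F : set (set ('I_n -> M))) :
  infinite_set [set: kappa] -> saturated kappa M -> small kappa A -> directed F ->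
  (forall X, F X -> definable_over A X /\ X !=set0) ->
  exists x, forall X, F X -> X x.
Proof.
move=> kinf sat; elim: n A F => [|n IH] A F sA Fdir FA.
  exists (pt0 M) => X /FA[_ [x Xx]]; by rewrite (pt0_unique (pt0 M) x).
move: F Fdir FA; rewrite -addn1 => F Fdir FA.
pose F' := [set [set x | exists t, X (join x (pt t))] | X in F].
have [||x F'x] := IH A F' sA.
- split; first by have [[X FX] _] := Fdir;
    exists [set x | exists t, X (join x (pt t))], X.
  move=> _ _ [X FX <-] [Y FY <-]; have [Z FZ ZXY] := Fdir.2 _ _ FX FY.
  exists [set x | exists t, Z (join x (pt t))]; first by exists Z.
  by move=> x [t /ZXY[]]; split; exists t.
- move=> _ [X FX <-]; have [XA [z Xz]] := FA _ FX; split.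
    exact: definable_over_exists.
  by have [x [t e]] := join1P z; exists x, t; rewrite -e.
pose p := [set th : pformula M 1 | params_in (A `|` range x) th /\
                                   exists2 X, F X & psol th = fiber X x].
have [|th [] //|q qp qfin|a pa] := sat (A `|` range x) _ p.
- apply: smallU => //; apply: small_finite => //.
  exact: finite_image finite_finset.
- pose G := [set X | F X /\ exists2 th, q th & psol th = fiber X x].
  have [r rP] : exists r : pformula M 1 -> set ('I_(n + 1) -> M),
      forall th, q th -> F (r th) /\ psol th = fiber (r th) x.
    have /choice[r rP] : forall th, exists X, q th -> F X /\ psol th = fiber X x.
      move=> th; have [/qp[_ [X FX e]]|nq] := pselect (q th); first by exists X.
      by exists setT.
    by exists r.
  have [|Z FZ Zq] := directed_finite Fdir (finite_image r qfin).
  + by move=> _ [th qth <-]; have [] := rP _ qth.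
  + have [a Za] : exists t, Z (join x (pt t)).
      by apply: (F'x [set x | exists t, Z (join x (pt t))]); exists Z.
    exists a => th qth; rewrite (rP _ qth).2.
    by apply: Zq Za; exists th.
exists (join x (pt a)) => X FX.
have [th [thA e]] := definable_over_fiber x (FA _ FX).1.
have : p th by split=> //; exists X.
by move=> /pa; rewrite -e.
Qed.

(** * Dimension functions *)

(* [dge k e] reads "e >= k", so that the values of a dimension can be compared
   through their up-sets. *)
Definition dge k (e : dimval) := if e is Some l then k <= l else false.

Lemma dge_ext (e e' : dimval) : (forall k, dge k e = dge k e') -> e = e'.
Proof.
case: e e' => [k|] [l|] h //; first congr Some.
- by apply/eqP; have := h l; have := h k; rewrite /= !leqnn eqn_leq => <- ->.
- by have := h 0.
- by have := h 0.
Qed.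

Lemma dge_dmax k (e e' : dimval) : dge k (dmax e e') = dge k e || dge k e'.
Proof. by case: e e' => [a|] [b|] //=; rewrite ?leq_max ?orbF. Qed.

(** At [k = 0] both sides test for a value other than [None], so the truncated predecessor is
    correct. *)
Lemma dge_succ k (e : dimval) : dge k (omap (addn^~ 1) e) = dge k.-1 e.
Proof. by case: e => [a|] //=; case: k => //= k; rewrite addn1. Qed.

Lemma dge_leq k l (e : dimval) : k <= l -> dge l e -> dge k e.
Proof. by case: e => //= a; exact: leq_trans. Qed.

Lemma dge_Some k (e : dimval) : e = Some k <-> dge k e /\ ~~ dge k.+1 e.
Proof.
split=> [->|] /=; first by rewrite ltnn leqnn.
by case: e => [a|] [] //= ka; rewrite -leqNgt => ak; congr Some; apply/eqP;
  rewrite eqn_leq ak.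
Qed.

Lemma dge_None (e : dimval) : e = None <-> ~~ dge 0 e.
Proof. by case: e. Qed.

(* phi((x, t), y) becomes phi'(t, (x, y)). *)
Definition rotate_last m n : 'I_(m + 1 + n) -> 'I_(1 + (m + n)) :=
  join (join (@rshift 1 (m + n) \o @lshift m n) (@lshift 1 (m + n)))
       (@rshift 1 (m + n) \o @rshift m n).

Lemma fiber_solset L (M : structure L) m n (phi : formula L (m + 1 + n))
    (x : 'I_m -> M) (w : 'I_n -> M) :
  fiber (solset phi w) x = solset (rename phi (@rotate_last m n)) (join x w).
Proof.
apply: funext => t; apply/propext; rewrite /fiber /solset /= sat_rename.
by rewrite /rotate_last !join_comp !compA !join_rshift !join_lshift.
Qed.

Lemma definable_over_solset L (M : structure L) m n (phi : formula L (m + n))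
    (w : 'I_n -> M) : definable_over (range w) (solset phi w).
Proof. by apply: definable_by_range; exists phi. Qed.

Lemma definable_solset L (M : structure L) m n (phi : formula L (m + n))
    (w : 'I_n -> M) : definable (solset phi w).
Proof. exact: definable_over_definable (definable_over_solset _ _). Qed.

(** The base point and the parameters of [U] enter [psi] together as one argument, so a condition on
    fibers that is expressed without parameters adds none. This serves both [dim_ext] and
    [dim_cl]. *)
Lemma level_definable_over L (M : structure L) (d : dimfun M) i :
  (forall n (phi : formula L (1 + n)), exists psi : formula L n,
     forall y, sat psi y <-> d 1 (solset phi y) = Some i) ->
  forall m (U : set ('I_(m + 1) -> M)) A,
    definable_over A U -> definable_over A (level d U i).
Proof.
move=> dform m U A /definable_overP[p [w [wA [phi ->]]]].
have [psi psiP] := dform _ (rename phi (@rotate_last m p)).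
apply/definable_overP; exists p, w; split=> //; exists psi.
apply: funext => x; apply/propext.
by rewrite /level /mkset (fiber_solset phi x w) psiP.
Qed.

Section Dimension.
Variables (L : language) (K : structure L) (d : dimfun K).
Hypothesis dd : is_dimension d.

Lemma dim_sub m (S T : set ('I_m -> K)) k : definable S -> definable T -> S `<=` T ->
  dge k (d S) -> dge k (d T).
Proof.
by move=> dS dT /setUidPr <- h; rewrite (dim2 dd) // dge_dmax h.
Qed.

Lemma dim_nonempty m (S : set ('I_m -> K)) : definable S -> dge 0 (d S) <-> S !=set0.
Proof.
move=> dS; have := dim1_empty dd dS; have := dge_None (d S).
case: (dge 0 _) => -[h1 h2] [h3 h4]; split=> //.
  by move=> _; apply/set0P/eqP => /h4/h1.
by move=> [x Sx]; move: Sx; rewrite h3 ?h2.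
Qed.

Lemma fiberT m n (x : 'I_m -> K) : fiber [set: 'I_(m + n) -> K] x = setT.
Proof. by apply/seteqP; split. Qed.

(** The value at [K^0] is not among the normalizations in (Dim 1); (Dim 4) applied to the line gives
    [1 = d(K^0) + 1]. *)
Lemma dim_point0 : d [set: 'I_0 -> K] = Some 0.
Proof.
have := @dim4_add _ _ _ dd 0 setT 1 (definable_overT _ _) isT.
have -> : level d [set: 'I_(0 + 1) -> K] 1 = setT.
  by apply/seteqP; split=> x // _; rewrite /level /= fiberT (dim1_line dd).
rewrite setTI [d _](dim1_line dd).
by case: (d _) => //= k; rewrite addn1 => -[<-].
Qed.

Lemma dim_line_le (S : set ('I_1 -> K)) : definable S -> ~~ dge 2 (d S).
Proof.
move=> dS; apply/negP => /(dim_sub dS (definable_overT _ _) (@subsetT _ _)).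
by rewrite (dim1_line dd).
Qed.

Lemma dim_line (S : set ('I_1 -> K)) : definable S -> S !=set0 ->
  d S = Some 0 \/ d S = Some 1.
Proof.
move=> dS S0; have := dim_line_le dS; have/(dim_nonempty dS) := S0.
by case: (d S) => // -[|[|k]] //= _ _; [left|right].
Qed.

Lemma dim_level_def m (U : set ('I_(m + 1) -> K)) (i : nat) : i <= 1 ->
  definable U -> definable (level d U i).
Proof. by move=> i1 /(dim4_definable dd); apply. Qed.

(** A nonempty fiber on the line has dimension 0 or 1, so the two pieces of (Dim 4) cover [U], and
    (Dim 2) takes their maximum. *)
Lemma dim_fibration m (U : set ('I_(m + 1) -> K)) : definable U ->
  d U = dmax (d (level d U 0)) (omap (addn^~ 1) (d (level d U 1))).
Proof.
move=> dU.
have dW i : i <= 1 -> definable (U `&` [set z | level d U i (proj z)]).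
  move=> i1; apply: definable_overI => //.
  exact: (definable_over_preimage (@lshift m 1) (dim_level_def i1 dU)).
rewrite -(dim4_add dd dU (leqnn 1)).
have -> : d (level d U 0) = d (U `&` [set z | level d U 0 (proj z)]).
  by rewrite (dim4_add dd dU) //; case: (d _) => //= k; rewrite addn0.
rewrite -(dim2 dd (dW 0 isT) (dW 1 isT)); congr (d _); apply/seteqP;
  split=> [z Uz|z [[]|[]]//].
have [x [t e]] := join1P z; rewrite e in Uz *.
have [||h|h] := @dim_line (fiber U x).
- exact: (definable_over_definable (definable_over_fiber x dU)).
- by exists (pt t).
- by left; split=> //; rewrite /= proj_join.
- by right; split=> //; rewrite /= proj_join.
Qed.

(** This uniform bound is what later keeps every definable set of [M] from exceeding all finite
    values. *)
Lemma dim_le m (S : set ('I_m -> K)) : definable S -> ~~ dge m.+1 (d S).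
Proof.
elim: m S => [|m IH] S.
  move=> dS; apply/negP => /(dim_sub dS (definable_overT _ _) (@subsetT _ _)).
  by rewrite dim_point0.
move: S; rewrite -addn1 => S dS;
  rewrite dim_fibration // dge_dmax dge_succ addn1 negb_or /=.
rewrite (IH _ (dim_level_def (leqnn 1) dS)) andbT.
by apply: contra (IH _ (dim_level_def (leq0n 1) dS)); exact: dge_leq (leqnSn _).
Qed.

Lemma solsetE m n (phi : formula L (m + n)) y :
  solset phi y = fiber [set z : 'I_(n + m) -> K |
     sat phi (join (z \o @rshift n m) (z \o @lshift n m))] y.
Proof.
by apply/seteqP; split=> x; rewrite /fiber /solset /= join_lshift join_rshift.
Qed.

Lemma definable_over_solset0 m n (phi : formula L (m + n)) :
  definable_over set0 [set z : 'I_(n + m) -> K |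
     sat phi (join (z \o @rshift n m) (z \o @lshift n m))].
Proof.
apply/definable_over_empty; exists (rename phi (join (@rshift n m) (@lshift n m))).
by apply: funext => z; apply/propext; rewrite /mkset sat_rename join_comp.
Qed.

(** (Dim 4) preserves the parameters of [U]; applied with no parameters at all, it produces one
    formula valid for every [y]. *)
Lemma level_formula n (phi : formula L (1 + n)) i : i <= 1 ->
  exists psi : formula L n, forall y, sat psi y <-> d (solset phi y) = Some i.
Proof.
move=> i1; have := dim4_definable dd (definable_over_solset0 phi) i1.
move=> /definable_over_empty[psi e]; exists psi => y.
by rewrite -[sat psi y]/([set x | sat psi x] y) -e /level /mkset -solsetE.
Qed.

(** With up-sets the recursion becomes a disjunction: one of the level sets, themselves given by
    formulas in [y], has to reach its threshold, [k] for level 0 and [k.-1] for level 1. *)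
Lemma dim_formula m n (phi : formula L (m + n)) k : exists psi : formula L n,
  forall y : 'I_n -> K, sat psi y <-> dge k (d (solset phi y)).
Proof.
elim: m n phi k => [|m IH] n phi k.
  have dphi (y : 'I_n -> K) : definable (solset phi y) by exact: definable_solset.
  case: k => [|k].
    exists phi => y; rewrite dim_nonempty //; split=> [h|[x]].
      by exists (pt0 K); rewrite /solset /= join0l.
    by rewrite /solset /= join0l.
  exists (Fls L n) => y; split=> //=.
  by move=> h; have /negP[] := dim_le (dphi y); exact: dge_leq h.
move: phi; rewrite -addn1 => phi.
have [th0 th0P] := level_formula (rename phi (@rotate_last m n)) (leq0n 1).
have [th1 th1P] := level_formula (rename phi (@rotate_last m n)) (leqnn 1).
have [psi0 psi0P] := IH _ th0 k; have [psi1 psi1P] := IH _ th1 k.-1.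
exists (Disj psi0 psi1) => y; rewrite sat_disj psi0P psi1P.
rewrite dim_fibration ?dge_dmax ?dge_succ; last exact: definable_solset.
have e0 : level d (solset phi y) 0 = solset th0 y.
  by apply/seteqP; split=> x; rewrite /level /= fiber_solset /solset /= th0P.
have e1 : level d (solset phi y) 1 = solset th1 y.
  by apply/seteqP; split=> x; rewrite /level /= fiber_solset /solset /= th1P.
by rewrite e0 e1; split=> [[] ->//|/orP//]; rewrite orbT.
Qed.

End Dimension.

(** * The extension of a dimension function *)

(** The formula [b] is chosen before the structure [N], so the same one can be read in [K] and in
    [M]. *)
Lemma forall_block L m p (a : formula L (m + p)) : exists b : formula L p,
  forall (N : structure L) (v : 'I_p -> N),
    sat b v <-> forall x : 'I_m -> N, sat a (join x v).
Proof.
elim: m a => [|m IH].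
  move=> a; exists a => N v; split=> [h x|/(_ (pt0 N))]; by rewrite join0l.
rewrite -addn1 => a.
pose f := join (join (@lshift (m + p) 1 \o @lshift m p) (@rshift (m + p) 1))
               (@lshift (m + p) 1 \o @rshift m p).
have fE (N : structure L) (x : 'I_m -> N) (v : 'I_p -> N) t :
    sat (rename a f) (join (join x v) (pt t)) <-> sat a (join (join x (pt t)) v).
  by rewrite sat_rename /f !join_comp !compA !join_lshift !join_rshift.
have [b bP] := IH (All (rename a f)); exists b => N v; rewrite bP.
split=> [h x|h x t]; last exact/fE.
by have [y [t ->]] := join1P x; apply/fE/h.
Qed.

Section Extension.
Variables (L : language) (K M : structure L) (d : dimfun K) (j : K -> M).
Hypotheses (dd : is_dimension d) (jel : elementary j).

Let D : dimfun M := @dim_ext L K M d.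

Definition dge_formula m n (phi : formula L (m + n)) k : formula L n :=
  sval (cid (dim_formula dd phi k)).

Definition dim_val_formula m n (phi : formula L (m + n)) (e : dimval) : formula L n :=
  if e is Some k then Conj (dge_formula phi k) (Neg (dge_formula phi k.+1))
  else Neg (dge_formula phi 0).

Lemma sat_dge_formula m n (phi : formula L (m + n)) k (y : 'I_n -> K) :
  sat (dge_formula phi k) y <-> dge k (d (solset phi y)).
Proof. exact: (svalP (cid (dim_formula dd phi k))). Qed.

Lemma sat_dim_val_formula m n (phi : formula L (m + n)) e (y : 'I_n -> K) :
  sat (dim_val_formula phi e) y <-> d (solset phi y) = e.
Proof.
case: e => [k|]; rewrite /dim_val_formula ?sat_conj sat_neg !sat_dge_formula.
  by rewrite dge_Some; split=> -[-> /negP].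
by rewrite dge_None; split=> /negP.
Qed.

(** Equality of two definable sets is a first-order condition [th] on the pair of parameter tuples,
    so the implication is valid in [K] and passes to [M]. Hence the value in [M] depends on the set
    and not on the formula defining it. *)
Lemma transfer_solset m n n' (phi : formula L (m + n)) (phi' : formula L (m + n'))
    (psi : formula L n) (psi' : formula L n') :
  (forall (y : 'I_n -> K) (y' : 'I_n' -> K),
     solset phi y = solset phi' y' -> sat psi y -> sat psi' y') ->
  forall (b : 'I_n -> M) (b' : 'I_n' -> M),
     solset phi b = solset phi' b' -> sat psi b -> sat psi' b'.
Proof.
move=> Kh b b'.
pose l := join (@lshift m (n + n')) (@rshift m (n + n') \o @lshift n n').
pose l' := join (@lshift m (n + n')) (@rshift m (n + n') \o @rshift n n').
have [th thP] := forall_block (Conj (Imp (rename phi l) (rename phi' l'))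
                                  (Imp (rename phi' l') (rename phi l))).
have thE (N : structure L) (v : 'I_n -> N) (v' : 'I_n' -> N) :
    sat th (join v v') <-> solset phi v = solset phi' v'.
  have lE (x : 'I_m -> N) : sat (rename phi l) (join x (join v v')) <-> solset phi v x.
    by rewrite sat_rename join_comp compA join_lshift join_rshift join_lshift.
  have lE' (x : 'I_m -> N) : sat (rename phi' l') (join x (join v v')) <-> solset phi' v' x.
    by rewrite sat_rename join_comp compA join_lshift !join_rshift.
  rewrite thP; split=> [h|e x].
    apply/seteqP; split=> x.
      by move=> /lE; have [h1 _] := (sat_conj _ _ _).1 (h x) => /h1/lE'.
    by move=> /lE'; have [_ h1] := (sat_conj _ _ _).1 (h x) => /h1/lE.
  by rewrite sat_conj /= lE lE' e.
have Kv : forall v : 'I_(n + n') -> K, sat (Imp th (Imp (rename psi (@lshift n n'))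
    (rename psi' (@rshift n n')))) v.
  move=> v; have [y [y' ->]] := joinP v => /= /thE e.
  by rewrite !sat_rename join_lshift join_rshift; exact: Kh.
have /= := elementary_valid jel Kv (join b b').
by rewrite thE !sat_rename join_lshift join_rshift.
Qed.

Lemma transfer_imp n (psi psi' : formula L n) :
  (forall y : 'I_n -> K, sat psi y -> sat psi' y) ->
  forall b : 'I_n -> M, sat psi b -> sat psi' b.
Proof. by move=> Kh b; exact: (elementary_valid jel (a := Imp psi psi')). Qed.

Lemma dim_val_formula_fun m n (phi : formula L (m + n)) n' (phi' : formula L (m + n'))
    e e' (b : 'I_n -> M) (b' : 'I_n' -> M) :
  solset phi b = solset phi' b' ->
  sat (dim_val_formula phi e) b -> sat (dim_val_formula phi' e') b' -> e = e'.
Proof.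
move=> eb sb sb'; apply: contrapT => ne.
have : sat (Neg (dim_val_formula phi' e')) b'.
  apply: (transfer_solset _ eb sb) => y y' ey /sat_dim_val_formula.
  by move=> ee; rewrite sat_neg sat_dim_val_formula -ey ee.
exact.
Qed.

(** If no value were attained at [b], induction on [k] would give every [dge_formula phi k] there,
    whereas the one for [m.+1] fails throughout [K] and hence in [M]. *)
Lemma dim_val_formula_ex m n (phi : formula L (m + n)) (b : 'I_n -> M) :
  exists e, sat (dim_val_formula phi e) b.
Proof.
apply: contrapT => /forallNP no.
suff all_ge k : sat (dge_formula phi k) b.
  have Kle : forall v : 'I_n -> K, sat (Neg (dge_formula phi m.+1)) v.
    by move=> v; rewrite sat_neg sat_dge_formula; exact/negP/dim_le/definable_solset.
  exact: (elementary_valid jel Kle b (all_ge _)).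
elim: k => [|k IH]; apply: contrapT => nk; first exact: no None nk.
by apply: (no (Some k)); apply/sat_conj; split.
Qed.

(** [dim_ext] admits any pair of formulas; [transfer_solset] shows that all admissible pairs agree
    with the chosen one. When no [k] exists, the default [None] is the right value. *)
Lemma dim_extE m n (phi : formula L (m + n)) (b : 'I_n -> M) e :
  D (solset phi b) = e <-> sat (dim_val_formula phi e) b.
Proof.
have key k n' (phi' : formula L (m + n')) psi (b' : 'I_n' -> M) :
    (forall y : 'I_n' -> K, sat psi y <-> d (solset phi' y) = Some k) ->
    solset phi b = solset phi' b' -> sat psi b' -> sat (dim_val_formula phi (Some k)) b.
  move=> psiP /esym eb; apply: transfer_solset eb => y y' ey /psiP.
  by rewrite sat_dim_val_formula ey.
have [e0 e0P] := dim_val_formula_ex phi b.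
suff De : D (solset phi b) = e0.
  by split=> [<-|/(dim_val_formula_fun erefl e0P)<-//]; rewrite De.
rewrite /D /dim_ext;
  case: xgetP => [e' _ [k [-> [n' [phi' [psi [b' [eb psiP psib]]]]]]]|no].
  by apply/esym/(dim_val_formula_fun erefl e0P); exact: key psiP eb psib.
case: e0 e0P => // k kP; have [] := no (Some k); exists k; split=> //.
exists n, phi, (dim_val_formula phi (Some k)), b; split=> // y.
exact: sat_dim_val_formula.
Qed.

(** Most clauses are written as implications between formulas that fix dimension values, valid for
    all tuples of [K]. The values at the given tuple of [M] are named first, so that these formulas
    are determined. *)
Lemma dim_ext_dimension : is_dimension D.
Proof.
split.
- move=> m S [[n phi b] [_ ->]]; rewrite -[psol _]/(solset phi b) dim_extE.
  have [th thP] := forall_block (Neg phi).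
  have thE (N : structure L) (v : 'I_n -> N) : sat th v <-> solset phi v = set0.
    rewrite thP; split=> [h|e x]; last by change (~ solset phi v x); rewrite e.
    by apply/seteqP; split=> // x /h.
  rewrite -thE; split.
    apply: transfer_imp => y; rewrite sat_dim_val_formula thE.
    by move=> /(dim1_empty dd (definable_solset phi y)).
  apply: transfer_imp => y; rewrite sat_dim_val_formula thE.
  by move=> /(dim1_empty dd (definable_solset phi y)).
- move=> a; pose phi := Equ (Var L (lshift 1 (@ord0 0))) (Var L (rshift 1 (@ord0 0))).
  have phiE (N : structure L) (y : 'I_1 -> N) : solset phi y = [set pt (y ord0)].
    apply/seteqP; split=> x; rewrite /solset /= joinl joinr.
      by move=> e; rewrite -(pt_ord0 x) e.
    by move=> ->.
  rewrite -[pt a]/(pt (pt a ord0)) -phiE dim_extE.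
  apply: (elementary_valid jel) => v; rewrite sat_dim_val_formula phiE.
  exact: dim1_point.
- pose phi := Neg (Fls L (1 + 0)).
  have phiE (N : structure L) (y : 'I_0 -> N) : solset phi y = setT.
    by apply/seteqP; split=> // x _ [].
  rewrite -(phiE M (pt0 M)) dim_extE.
  apply: (elementary_valid jel) => v; rewrite sat_dim_val_formula phiE.
  exact: dim1_line.
- move=> m S1 S2 d1 d2.
  have [p [w [_ [a1 ->] [a2 ->]]]] := definable_over_common d1 d2.
  have := dim_val_formula_ex a1 w; have := dim_val_formula_ex a2 w.
  move=> [e2 h2] [e1 h1].
  move: (h1) (h2) => /dim_extE D1 /dim_extE D2.
  have UE (N : structure L) (v : 'I_p -> N) :
      solset a1 v `|` solset a2 v = solset (Disj a1 a2) v.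
    by apply: funext => x; apply/propext; exact: iff_sym (sat_disj _ _ _).
  rewrite -/(solset a1 w) -/(solset a2 w) D1 D2 UE dim_extE.
  have Kh (v : 'I_p -> K) : sat (dim_val_formula a1 e1) v ->
      sat (dim_val_formula a2 e2) v -> sat (dim_val_formula (Disj a1 a2) (dmax e1 e2)) v.
    rewrite !sat_dim_val_formula => <- <-.
    by rewrite -UE (dim2 dd) //; exact: definable_solset.
  exact: (elementary_valid jel (a := Imp _ (Imp _ _)) Kh w).
- move=> m S s [[n phi b] [_ ->]]; rewrite -[psol _]/(solset phi b).
  have [e eP] := dim_val_formula_ex phi b; move: (eP) => /dim_extE De.
  pose phi' := rename phi (join (@lshift m n \o (s^-1)%g) (@rshift m n)).
  have phiE (N : structure L) (y : 'I_n -> N) :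
      [set x \o s | x in solset phi y] = solset phi' y.
    have h x : solset phi' y x <-> solset phi y (x \o (s^-1)%g).
      by rewrite /solset /= sat_rename join_comp compA join_lshift join_rshift.
    apply/seteqP; split=> x.
      move=> [u ux <-]; rewrite h; congr (solset phi y _) : ux.
      by apply: funext => i /=; rewrite permKV.
    move=> /h ux; exists (x \o (s^-1)%g) => //.
    by apply: funext => i /=; rewrite permK.
  rewrite phiE De dim_extE.
  apply: transfer_imp eP => y /sat_dim_val_formula <-.
  by rewrite sat_dim_val_formula -phiE (dim3 dd) //; exact: definable_solset.
- move=> m U A i UA i1; apply: level_definable_over UA => n phi.
  by exists (dim_val_formula phi (Some i)) => y; rewrite dim_extE.
- move=> m U i [[n phi b] [_ ->]] i1; rewrite -[psol _]/(solset phi b).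
  pose th := dim_val_formula (rename phi (@rotate_last m n)) (Some i).
  have levM : level D (solset phi b) i = solset th b.
    by apply: funext => x; apply/propext; rewrite /level /mkset fiber_solset dim_extE.
  have levK y : level d (solset phi y) i = solset th y.
    by apply: funext => x; apply/propext;
      rewrite /level /mkset fiber_solset -sat_dim_val_formula.
  rewrite levM.
  pose chi := Conj phi (rename th (join (@lshift (m + 1) n \o @lshift m 1) (@rshift (m + 1) n))).
  have chiE (N : structure L) (v : 'I_n -> N) :
      solset phi v `&` [set z | solset th v (proj z)] = solset chi v.
    apply: funext => z; apply/propext; apply: iff_sym;
      rewrite /solset /mkset sat_conj sat_rename.
    by rewrite join_comp compA join_lshift join_rshift.
  rewrite chiE.
  have [e eP] := dim_val_formula_ex th b.
  move: (eP) => /dim_extE De; rewrite De dim_extE.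
  apply: transfer_imp eP => y /sat_dim_val_formula <-.
  rewrite sat_dim_val_formula -chiE -levK (dim4_add dd) //; exact: definable_solset.
Qed.

End Extension.

(** * Rank in a matroid *)

Section Rank.
Variables (M : Type) (cl : set M -> set M).
Hypothesis clm : is_matroid cl.

Lemma cl_sub (X Y : set M) : X `<=` cl Y -> cl X `<=` cl Y.
Proof. by move=> /(cl_monotone clm); rewrite (cl_idempotent clm). Qed.

Lemma cl_sub_mem (X : set M) a : X a -> cl X a.
Proof. exact: cl_extensive. Qed.

Section Tuple.
Variables (n : nat) (b : 'I_n -> M) (A : set M).

Definition span_of (I : {set 'I_n}) := cl (A `|` [set b k | k in [set` I]]).

Lemma indepE (I : {set 'I_n}) : indep cl b A I <->
  forall i, i \in I -> ~ span_of (I :\ i)%SET (b i).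
Proof.
have E i : [set k | k \in I /\ k != i] = [set` (I :\ i)%SET].
  by apply: funext => k; apply/propext; rewrite /= !inE; split=> [[-> ->]|/andP[]].
by rewrite /span_of; split=> h i /h; rewrite E.
Qed.

Lemma span_sub (I : {set 'I_n}) (X : set M) :
  A `<=` cl X -> (forall i, i \in I -> cl X (b i)) -> span_of I `<=` cl X.
Proof. by move=> AX IX; apply: cl_sub => x [/AX|[i iI <-]] //; exact: IX. Qed.

Lemma span_mem (I : {set 'I_n}) i : i \in I -> span_of I (b i).
Proof. by move=> iI; apply: cl_sub_mem; right; exists i. Qed.

Lemma span_base (I : {set 'I_n}) : A `<=` span_of I.
Proof. by move=> x Ax; apply: cl_sub_mem; left. Qed.

Lemma span_mono (I J : {set 'I_n}) : I \subset J -> span_of I `<=` span_of J.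
Proof.
move=> /fintype.subsetP IJ; apply: span_sub; first exact: span_base.
by move=> i /IJ; exact: span_mem.
Qed.

Lemma span_exchange (I : {set 'I_n}) i x : span_of (i |: I)%SET x -> ~ span_of I x ->
  cl (A `|` [set b k | k in [set` I]] `|` [set x]) (b i).
Proof.
move=> h nx; apply: (cl_exchange clm) nx; move: h; congr (cl _ x).
rewrite -setUA; congr (_ `|` _); apply/seteqP; split=> y /=.
  by move=> [k]; rewrite /= !inE => /orP[/eqP->|kI] <-; [right|left; exists k].
by move=> [[k kI <-]|->]; [exists k|exists i] => //=; rewrite !inE ?eqxx // kI orbT.
Qed.

(* Steinitz: trade an element of [J] for one of [I] until [I] is contained
   in the spanning set. *)
Lemma indep_card_le (I J : {set 'I_n}) : indep cl b A I ->
  (forall i, span_of J (b i)) -> #|I| <= #|J|.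
Proof.
move=> /indepE Iind; have [k] := ubnP #|I :\: J|%SET.
elim: k J => // k IH J Jk Jsp.
have [IJ|] := boolP (I \subset J); first exact: subset_leq_card.
move=> /subsetPn[i iI iJ].
(* Take [J0] minimal among the sets between [I :&: J] and [J] that span [b i]. Independence of [I]
   forces some [j] of [J0] outside [I], and minimality lets exchange replace [j] by [i]. *)
pose P (J0 : {set 'I_n}) := [&& I :&: J \subset J0, J0 \subset J & `[< span_of J0 (b i) >]]%SET.
have PJ : P J by rewrite /P finset.subsetIr subxx; apply/asboolP.
have [J0 /minsetP[/and3P[IJ0 J0J /asboolP J0i] J0min] _] := minset_exists PJ.
have [j jJ0 jI] : exists2 j, j \in J0 & j \notin I.
  apply: contrapT => h; apply: (Iind _ iI); apply: span_mono J0i.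
  apply/fintype.subsetP => j jJ0; rewrite !inE; have jI : j \in I.
    by apply: contrapT => /negP jI; apply: h; exists j.
  rewrite jI andbT; apply: contra iJ => /eqP <-; exact: (fintype.subsetP J0J).
have nji : ~ span_of (J0 :\ j)%SET (b i).
  move=> h; have : (J0 :\ j)%SET = J0.
    apply: J0min (finset.subD1set _ _);
      rewrite /P (fintype.subset_trans (finset.subD1set _ _) J0J) /=.
    apply/andP; split; last exact/asboolP.
    apply/fintype.subsetP => l lIJ; rewrite !inE (fintype.subsetP IJ0 _ lIJ) andbT.
    by apply: contra jI => /eqP <-; move: lIJ; rewrite inE => /andP[].
  by move=> e; move: jJ0; rewrite -e !inE eqxx.
pose J' := (i |: (J :\ j))%SET.
have jJ : j \in J by exact: (fintype.subsetP J0J).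
have J'j : span_of J' (b j).
  have := J0i; rewrite -(finset.setD1K jJ0) => /span_exchange /(_ nji).
  apply: cl_monotone => // x [[Ax|[l lJ0 <-]]|->]; [by left| |].
    right; exists l => //=; move: lJ0; rewrite /= !inE => /andP[-> lJ0].
    by rewrite (fintype.subsetP J0J) // orbT.
  by right; exists i => //=; rewrite !inE eqxx.
have J'sp l : span_of J' (b l).
  apply: span_sub (Jsp l); first exact: span_base.
  move=> m mJ; have [->//|mj] := eqVneq m j.
  by apply: span_mem; rewrite !inE mj mJ orbT.
apply: leq_trans (IH J' _ J'sp) _.
  rewrite -ltnS; apply: leq_trans Jk; rewrite ltnS.
  apply: proper_card; apply/properP; split.
    apply/fintype.subsetP => l;
      rewrite !inE negb_or negb_and negbK => /andP[/andP[li]].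
    by case/orP=> [/eqP->|->] // jI'; rewrite jI' in jI.
  by exists i; rewrite !inE ?iJ // eqxx.
rewrite /J' cardsU1 !inE (negbTE iJ) andbF /= (cardsD1 j J) jJ //.
Qed.

(** An index that is not spanned could be added: a dependence of [b k] on the enlarged set would, by
    exchange, put [b i] in the span of [I]. *)
Lemma maxset_indep_span (I : {set 'I_n}) :
  maxset (fun I => `[< indep cl b A I >]) I -> forall i, span_of I (b i).
Proof.
move=> /maxsetP[/asboolP /indepE Iind Imax] i; apply: contrapT => ni.
have iI : i \notin I by apply/negP => /span_mem.
suff : (i |: I)%SET = I by move=> e; move: iI; rewrite -e finset.setU11.
apply: Imax; last exact: finset.subsetUr.
apply/asboolP/indepE => k; rewrite !inE => /orP[/eqP->|kI].
  by rewrite finset.setU1K.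
have ki : k != i by apply: contra iI => /eqP <-.
have -> : ((i |: I) :\ k = i |: (I :\ k))%SET.
  by apply/setP => l; rewrite !inE; case: (eqVneq l i) => [->|];
    rewrite ?andbT // eq_sym ki.
move=> /span_exchange /(_ (Iind _ kI)) h; apply: ni; apply: cl_monotone h => // x.
move=> [[Ax|[l /= lI <-]]|->]; [by left| |by right; exists k].
by right; exists l => //; move: lI; rewrite !inE => /andP[].
Qed.

(** Steinitz bounds all independent sets by [#|I|], and a maximal one containing [I] has at least
    that size. *)
Lemma rk_eq (I : {set 'I_n}) : indep cl b A I -> (forall i, span_of I (b i)) ->
  rk cl b A = #|I|.
Proof.
move=> Iind Isp; apply/eqP; rewrite eqn_leq; apply/andP; split.
  apply/bigmax_leqP => J /maxsetP[/asboolP Jind _].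
  exact: indep_card_le.
have I0 : `[< indep cl b A I >] by apply/asboolP.
have [J Jmax IJ] := maxset_exists (P := fun I => `[< indep cl b A I >]) I0.
exact: leq_trans (subset_leq_card IJ) (leq_bigmax_cond _ Jmax).
Qed.

Lemma basis_exists : exists2 I : {set 'I_n}, indep cl b A I & forall i, span_of I (b i).
Proof.
have I0 : `[< indep cl b A finset.set0 >] by apply/asboolP => i; rewrite inE.
have [J Jmax _] := maxset_exists (P := fun I => `[< indep cl b A I >]) I0.
exists J; last exact: maxset_indep_span.
by have /maxsetP[/asboolP] := Jmax.
Qed.

Lemma rk_le : rk cl b A <= n.
Proof.
apply/bigmax_leqP => I _; apply: leq_trans (max_card _) _; by rewrite card_ord.
Qed.

End Tuple.

(** A basis of [b], moved to the left block of indices, is a basis of the longer tuple once the last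
    index [r] is added exactly when [t] is not in the closure. *)
Lemma rk_join n (b : 'I_n -> M) t A : rk cl (join b (pt t)) A =
  rk cl b A + `[< ~ cl (A `|` range b) t >].
Proof.
have [I Iind Isp] := basis_exists b A; rewrite (rk_eq Iind Isp).
pose l := @lshift n 1; pose r := rshift n (@ord0 0).
have spE (J : {set 'I_n}) : span_of (join b (pt t)) A (l @: J)%SET = span_of b A J.
  congr (cl (_ `|` _)); apply/seteqP; split=> x /= [k].
    by move=> /= /imsetP[i iJ ->] <-; rewrite joinl; exists i.
  by move=> /= kJ <-; exists (l k); rewrite /= ?joinl //; exact: imset_f.
have spA : span_of b A I = cl (A `|` range b).
  apply/seteqP; split; last by apply: cl_sub => x [Ax|[i _ <-]];
    [exact: span_base|exact: Isp].
  by apply: cl_monotone => // x [|[i _ <-]]; [left|right; exists i].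
have linj : injective l by exact: lshift_inj.
have lD (J : {set 'I_n}) k : ((l @: J) :\ l k = l @: (J :\ k))%SET.
  apply/setP => x; rewrite !inE; apply/andP/imsetP => [[xk /imsetP[i iJ e]]|[i]].
    by exists i => //; rewrite !inE iJ andbT; apply: contra xk => /eqP <-; rewrite e.
  by rewrite !inE => /andP[ik iJ] ->; rewrite (inj_eq linj) ik imset_f.
have rl (J : {set 'I_n}) : r \notin (l @: J)%SET.
  by apply/imsetP => -[i _] /eqP; rewrite eq_sym eq_lrshift.
have [ct|nct] := pselect (cl (A `|` range b) t).
  rewrite (asboolF (P := ~ _)) ?addn0; last by [].
  rewrite -(card_imset _ linj); apply: rk_eq.
    apply/indepE => i /imsetP[k kI ->]; rewrite lD spE joinl.
    by have /indepE := Iind; apply.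
  move=> i; rewrite spE; case: (split_ordP i) => k ->; rewrite ?joinl // joinr.
  by rewrite spA.
have -> : #|I| + `[< ~ cl (A `|` range b) t >] = #|(r |: l @: I)%SET|.
  by rewrite asboolT //= cardsU1 rl card_imset // addnC.
apply: rk_eq; last first.
  move=> i; case: (split_ordP i) => k ->.
    have := Isp k; rewrite -spE joinl; apply: span_mono; exact: finset.subsetUr.
  by apply: span_mem; rewrite !inE (ord1 k) eqxx.
apply/indepE => i; rewrite !inE => /orP[/eqP->|/imsetP[k kI ->]].
  by rewrite finset.setU1K // spE spA joinr.
have -> : ((r |: l @: I) :\ l k = r |: (l @: (I :\ k)))%SET.
  rewrite -lD; apply/setP => x; rewrite !inE; case: (eqVneq x r) => [->|] //=.
  by rewrite eq_rlshift.
rewrite joinl => /span_exchange; rewrite spE.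
have /indepE nk := Iind; move=> /(_ (nk _ kI)) h; apply: nct; move: h; rewrite joinr.
apply: cl_sub => x [[Ax|[_ /imsetP[u uI ->] <-]]|->]; apply: cl_sub_mem;
  first by left.
  by right; exists u; rewrite ?joinl.
by right; exists k.
Qed.

Lemma rk_perm n (b : 'I_n -> M) (s : {perm 'I_n}) A : rk cl (b \o s) A = rk cl b A.
Proof.
have [I Iind Isp] := basis_exists b A; rewrite (rk_eq Iind Isp).
have spE (J : {set 'I_n}) : span_of (b \o s) A (s @^-1: J)%SET = span_of b A J.
  congr (cl (_ `|` _)); apply/seteqP; split=> x /= [k] /=.
    by rewrite inE => sk <-; exists (s k).
  move=> kJ <-; exists ((s^-1)%g k); rewrite /= ?inE ?permKV //.
apply: etrans (card_preimset I (@perm_inj _ s)).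
apply: rk_eq => [|i]; last by rewrite spE; exact: Isp.
apply/indepE => i; rewrite inE => si.
have -> : ((s @^-1: I) :\ i = s @^-1: (I :\ s i))%SET.
  by apply/setP => k; rewrite !inE (inj_eq perm_inj).
by rewrite spE; have /indepE := Iind; apply.
Qed.

End Rank.

(** * The dimension induced by a matroid *)

Section DimOver.
Variables (M : Type) (cl : set M -> set M).
Hypothesis clm : is_matroid cl.

Lemma dge_dim_over n (V : set ('I_n -> M)) A k :
  dge k (dim_over cl A V) <-> exists2 b, V b & k <= rk cl b A.
Proof.
rewrite /dim_over; case: asboolP => [->|/eqP/set0P[b0 Vb0]].
  by split=> // -[b []].
split=> /= [km|[b Vb kb]].
  have : exists2 b, V b &
      \max_(j < n.+1 | `[< exists2 b, V b & rk cl b A = j >]) j <= rk cl b A.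
    elim/big_ind: _ => [|x y [b Vb xb] [c Vc yc]|j /asboolP[b Vb bj]].
    - by exists b0.
    - by have [xy|yx] := leqP x y; [exists c|exists b].
    - by exists b; rewrite // bj.
  by move=> [b Vb mb]; exists b => //; exact: leq_trans mb.
have bn : rk cl b A < n.+1 by rewrite ltnS rk_le.
apply: leq_trans kb _.
by apply: (leq_bigmax_cond (Ordinal bn)); apply/asboolP; exists b.
Qed.

Lemma dim_overU n (V W : set ('I_n -> M)) A :
  dim_over cl A (V `|` W) = dmax (dim_over cl A V) (dim_over cl A W).
Proof.
apply: dge_ext => k; rewrite dge_dmax;
  apply/idP/orP => [/dge_dim_over[b [Vb|Wb] kb]|].
- by left; apply/dge_dim_over; exists b.
- by right; apply/dge_dim_over; exists b.
by move=> [] /dge_dim_over[b Vb kb]; apply/dge_dim_over; exists b => //; [left|right].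
Qed.

Lemma dim_over_perm n (V : set ('I_n -> M)) A (s : {perm 'I_n}) :
  dim_over cl A [set x \o s | x in V] = dim_over cl A V.
Proof.
apply: dge_ext => k; apply/idP/idP => /dge_dim_over[b Vb kb]; apply/dge_dim_over.
  by move: Vb kb => [x Vx <-]; rewrite rk_perm //; exists x.
by exists (b \o s); [exists b|rewrite rk_perm].
Qed.

Lemma dim_over_empty n (V : set ('I_n -> M)) A : dim_over cl A V = None <-> V = set0.
Proof. by rewrite /dim_over; case: asboolP. Qed.

Lemma rk0 (b : 'I_0 -> M) A : rk cl b A = 0.
Proof. by apply/eqP; rewrite -leqn0 rk_le. Qed.

Lemma rk_pt t A : rk cl (pt t) A = `[< ~ cl A t >].
Proof.
have := rk_join clm (pt0 M) t A; rewrite rk0 join0l => ->.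
suff -> : A `|` range (pt0 M) = A by [].
by apply/seteqP; split=> [x [|[[]]]|x] //; left.
Qed.

Lemma dim_over_point (V : set ('I_0 -> M)) A :
  dim_over cl A V = if `[< V = set0 >] then None else Some 0.
Proof.
apply: dge_ext => k; case: asboolP => [V0|/eqP/set0P[b Vb]].
  by rewrite (dim_over_empty V A).2.
by apply/idP/idP => [/dge_dim_over[c _]|k0]; [rewrite rk0|apply/dge_dim_over;
  exists b; rewrite ?rk0].
Qed.

Lemma dge_dim_over_line (X : set ('I_1 -> M)) A k : dge k (dim_over cl A X) <->
  exists2 t, X (pt t) & k <= `[< ~ cl A t >].
Proof.
rewrite dge_dim_over; split=> [[b Xb]|[t Xt kt]].
  by rewrite -(pt_ord0 b) rk_pt => kb; exists (b ord0); rewrite ?pt_ord0.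
by exists (pt t); rewrite // rk_pt.
Qed.

Lemma dim_over_line0 (X : set ('I_1 -> M)) A : dim_over cl A X = Some 0 <->
  X !=set0 /\ forall t, X (pt t) -> cl A t.
Proof.
rewrite dge_Some dge_dim_over_line; split=> [[[t Xt _] n1]|[[x Xx] h]].
  split; first by exists (pt t).
  move=> s Xs; apply: contrapT => ns; move/negP: n1; apply; apply/dge_dim_over_line.
  by exists s; rewrite // asboolT.
split; first by exists (x ord0); rewrite ?pt_ord0.
by apply/negP => /dge_dim_over_line[s /h cs]; rewrite asboolF //; apply.
Qed.

End DimOver.

(** By [rk_join], a point [(x, t)] gains rank over [x] exactly when [t] is generic over [A] and [x].
    Whether the fiber contains such a [t] is read off from [D], since the hypothesis on the line
    applies over [A] enlarged by the coordinates of [x]. *)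
Lemma dim_over_fibration kappa L (M : structure L) (cl : set M -> set M) (D : dimfun M) :
  infinite_set [set: kappa] -> is_matroid cl ->
  (forall A (X : set ('I_1 -> M)), small kappa A -> definable_over A X ->
     D 1 X = dim_over cl A X) ->
  forall A m (U : set ('I_(m + 1) -> M)), small kappa A -> definable_over A U ->
  dim_over cl A U =
    dmax (dim_over cl A (level D U 0)) (omap (addn^~ 1) (dim_over cl A (level D U 1))).
Proof.
move=> kinf clm Dline A m U sA AU.
have Dfib x : D 1 (fiber U x) = dim_over cl (A `|` range x) (fiber U x).
  apply: Dline; last exact: definable_over_fiber.
  by apply: smallU => //; apply: small_finite => //;
    exact: finite_image finite_finset.
apply: dge_ext => k; rewrite dge_dmax dge_succ; apply/idP/orP.
  move=> /dge_dim_over[z]; have [x [t ->]] := join1P z => Uxt.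
  rewrite rk_join // => kr.
  have := dge_dim_over_line clm (fiber U x) (A `|` range x).
  rewrite -Dfib => Dge.
  have D2 : ~~ dge 2 (D 1 (fiber U x)).
    by apply/negP => /Dge[s _]; case: `[< _ >].
  have D0 : dge 0 (D 1 (fiber U x)) by apply/Dge; exists t.
  have [t1|] := boolP `[< ~ cl (A `|` range x) t >].
    right; apply/dge_dim_over; exists x; last first.
      by move: kr; rewrite t1 addn1; case: k {Dge}.
    by apply/dge_Some; split=> //; apply/Dge; exists t; rewrite // t1.
  move=> /negbTE t0; rewrite t0 addn0 in kr.
  (* Here [t] is not generic, but its fiber may still contain a generic point; then [x] lies in
     level 1, where the weaker bound [k.-1] suffices. *)
  have [D1|D1] := boolP (dge 1 (D 1 (fiber U x))); [right|left];
    apply/dge_dim_over; exists x.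
  - exact/dge_Some.
  - exact: leq_trans (leq_pred k) kr.
  - exact/dge_Some.
  - exact: kr.
move=> [] /dge_dim_over[x /dge_Some[+ _] kr];
  rewrite Dfib => /(dge_dim_over_line clm)[t Ut kt];
  apply/dge_dim_over; exists (join x (pt t)) => //; rewrite rk_join //.
  exact: leq_trans kr (leq_addr _ _).
by case: k kr => //= k kr; rewrite -addn1 leq_add.
Qed.

(** * The matroid of a dimension function *)

Lemma dim_clP kappa L (M : structure L) (cl : set M -> set M) m (V : set ('I_m -> M)) :
  infinite_set [set: kappa] -> definable V ->
  exists A, [/\ small kappa A, definable_over A V & dim_cl kappa cl V = dim_over cl A V].
Proof.
move=> kinf /definable_over_finite[B [Bfin _ BV]].
rewrite /dim_cl; case: xgetP => [A _ [sA AV]|/(_ B)[]]; first by exists A.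
by split=> //; exact: small_finite.
Qed.

Section ClDim.
Variables (L : language) (M : structure L) (D : dimfun M).
Hypothesis dd : is_dimension D.
Let cl := cl_dim D.

Lemma dim_set0 m : D (set0 : set ('I_m -> M)) = None.
Proof. by apply/(dim1_empty dd) => //; exact: definable_over0. Qed.

Lemma cl_dimP A a : cl A a <->
  exists X : set ('I_1 -> M), [/\ definable_over A X, ~~ dge 1 (D X) & X (pt a)].
Proof.
split=> [[X [AX X0 Xa]]|[X [AX X0 Xa]]]; exists X; split=> //; first by rewrite X0.
apply/dge_Some; split=> //; apply/dim_nonempty => //; last by exists (pt a).
exact: definable_over_definable AX.
Qed.

Lemma cl_dim_mono A B : A `<=` B -> cl A `<=` cl B.
Proof. by move=> AB a [X [AX X0 Xa]]; exists X; split=> //;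
  exact: definable_over_sub AX. Qed.

Lemma cl_dim_ext A : A `<=` cl A.
Proof.
move=> a Aa; exists [set pt a]; split=> //; first exact: definable_over_set1.
exact: dim1_point.
Qed.

(* The part of [U] lying over the [t] in [Z] whose fiber has dimension 0,
   with its two coordinates swapped: its dimension is at most that of [Z]. *)
Lemma swap_finite_fibers A (U : set ('I_(1 + 1) -> M)) (Z : set ('I_1 -> M)) :
  definable_over A U -> definable_over A Z ->
  exists W : set ('I_(1 + 1) -> M), [/\ definable_over A W,
    forall x t, W (join (pt x) (pt t)) <->
      [/\ U (join (pt t) (pt x)), level D U 0 (pt t) & Z (pt t)] &
    forall k, dge k (D W) -> dge k (D Z)].
Proof.
move=> AU AZ.
pose s := tperm (lshift 1 (@ord0 0)) (rshift 1 (@ord0 0)).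
have sE x t : join (pt x) (pt t) \o s = join (pt t) (pt x) :> (_ -> M).
  apply: funext => i /=; case: (split_ordP i) => k ->; rewrite (ord1 k).
    by rewrite tpermL joinl joinr.
  by rewrite tpermR joinl joinr.
pose V := U `&` [set z | (level D U 0 `&` Z) (proj z)].
have A0 : definable_over A (level D U 0) by exact: dim4_definable.
have AV : definable_over A V.
  apply: definable_overI => //.
  exact: (definable_over_preimage (@lshift 1 1) (definable_overI A0 AZ)).
have dV := definable_over_definable AV.
pose W := [set z : 'I_(1 + 1) -> M | V (z \o s)].
have AW : definable_over A W by exact: definable_over_preimage.
have WE : W = [set z \o s | z in V].
  apply/seteqP; split=> z; first by move=> Vz; exists (z \o s) => //;
    apply: funext => i; rewrite /= tpermK.
  by move=> [y Vy <-]; rewrite /W /=; congr V : Vy; apply: funext => i;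
    rewrite /= tpermK.
exists W; split=> // [x t|k].
  by rewrite /W /V /mkset sE /= proj_join; split=> [[? []]|[]].
rewrite WE (dim3 dd) // (dim_fibration dd) // dge_dmax.
have VE y : fiber V y = fiber U y `&` [set t | (level D U 0 `&` Z) y].
  by rewrite /V /fiber; apply/seteqP; split=> t /=; rewrite proj_join.
have lev i : level D V i `<=` level D U 0 `&` Z `&` level D U i.
  move=> y; rewrite /level /= VE => Di.
  have yZ : (level D U 0 `&` Z) y.
    apply: contrapT => ny; move: Di.
    by rewrite (_ : _ `&` _ = set0) ?dim_set0 //; apply/seteqP; split=> t // [].
  by split=> //; rewrite -Di; congr (D _); apply/seteqP; split=> t // [].
rewrite (_ : level D V 1 = set0); last first.
  by apply/seteqP; split=> // y /lev [[]]; rewrite /level /= => ->.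
rewrite dim_set0 orbF.
apply: dim_sub => //; last by move=> y /lev[[]].
  exact: dim_level_def.
exact: definable_over_definable AZ.
Qed.

Lemma range_pt (a : M) : range (pt a) = [set a].
Proof. by apply/seteqP; split=> [x [i _ <-]|x ->] //; exists ord0. Qed.

(** With [b] in a fiber [U_c] of dimension 0 and [c] in [Z] of dimension 0, the swapped set [W] has
    dimension 0. Computed along the other coordinate, this makes the set of possible [b]
    zero-dimensional over [A]. *)
Lemma cl_dim_step A c : cl A c -> cl (A `|` [set c]) `<=` cl A.
Proof.
move=> [Z [AZ Z0 Zc]] b [X [AcX X0 Xb]].
have [U AU XU] := definable_over_setU1 AcX.
have [W [AW WP Wdim]] := swap_finite_fibers AU AZ.
have W1 : ~~ dge 1 (D W) by apply/negP => /Wdim; rewrite Z0.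
have Wbc : W (join (pt b) (pt c)).
  by apply/WP; split=> //; [move: Xb; rewrite XU|rewrite /level /= -XU].
have dW := definable_over_definable AW.
have := W1; rewrite (dim_fibration dd) // dge_dmax dge_succ negb_or => /andP[l0 l1].
apply/cl_dimP; exists (level D W 0); split=> //; first exact: dim4_definable.
have dWb := definable_over_definable (definable_over_fiber (pt b) AW).
(* A fiber of dimension 1 over [b] would make [level D W 1] nonempty and raise the dimension of [W]
   to at least 1. *)
have [|//|b1] := dim_line dd dWb; first by exists (pt c).
case/negP: l1; apply/(dim_nonempty dd); last by exists (pt b).
exact: dim_level_def.
Qed.

(** A definable set uses finitely many parameters, and [cl_dim_step] removes those in [cl A] one at
    a time. *)
Lemma cl_dim_idem A : cl (cl A) = cl A.
Proof.
apply/seteqP; split; last exact: cl_dim_ext.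
suff h p (w : 'I_p -> M) : (forall i, cl A (w i)) -> cl (A `|` range w) `<=` cl A.
  move=> b [X [/definable_overP[p [w [wA wX]]] X0 Xb]].
  apply: (h p w) => [i|]; first by apply: wA; exists i.
  by exists X; split=> //; apply/definable_overP; exists p, w; split=> // x; right.
elim: p w => [|p IH] w.
  suff -> : A `|` range w = A by move=> _ x.
  by apply/seteqP; split=> [x [|[[]]]|x] //; left.
move: w; rewrite -addn1 => w; have [u [c ->]] := join1P w => wA.
rewrite range_join range_pt setUA.
have uA i : cl A (u i) by have := wA (lshift 1 i); rewrite joinl.
apply: subset_trans (IH u uA); apply: cl_dim_step.
apply: (cl_dim_mono (@subsetUl _ _ _)).
by have := wA (rshift p ord0); rewrite joinr.
Qed.

(** The swapped set [W] has dimension at most 1. If its fiber over [a] has dimension 0, that fiber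
    puts [c] in the closure of [A] and [a]; otherwise [a] lies in [level D W 1], which has dimension
    below 1 because [W] has dimension below 2, so that [a] is in [cl A]. *)
Lemma cl_dim_exchange A a c : cl (A `|` [set c]) a -> ~ cl A a -> cl (A `|` [set a]) c.
Proof.
move=> [X [AcX X0 Xa]] nAa.
have [U AU XU] := definable_over_setU1 AcX.
have [W [AW WP Wdim]] := swap_finite_fibers AU (definable_overT A 1).
have W2 : ~~ dge 2 (D W) by apply/negP => /Wdim; rewrite (dim1_line dd).
have Wac : W (join (pt a) (pt c)).
  by apply/WP; split=> //; [move: Xa; rewrite XU|rewrite /level /= -XU].
have dW := definable_over_definable AW.
have AWa := definable_over_fiber (pt a) AW; rewrite range_pt in AWa.
have [|a0|a1] := dim_line dd (definable_over_definable AWa); first by exists (pt c).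
  by exists (fiber W (pt a)).
case: nAa; apply/cl_dimP; exists (level D W 1); split=> //;
  first exact: dim4_definable.
apply: contra W2 => l1.
by rewrite (dim_fibration dd) // dge_dmax dge_succ l1 orbT.
Qed.

Lemma cl_dim_matroid : is_matroid cl.
Proof.
split.
- exact: cl_dim_ext.
- exact: cl_dim_mono.
- exact: cl_dim_idem.
- move=> A; apply/seteqP; split=> a.
    move=> [X [/definable_over_finite[B [Bfin BA BX]] X0 Xa]].
    by exists B => //; exists X.
  by move=> [B [_ BA]]; exact: cl_dim_mono.
- exact: cl_dim_exchange.
Qed.

Lemma cl_dim_definable : definable_matroid cl.
Proof.
move=> A; apply/seteqP; split=> a.
  move=> [X [/definable_overP[p [w [wA [phi XE]]]] X0 Xa]].
  have [psi psiP] := level_formula dd phi (leq0n 1).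
  (* Conjoining the parameter-free condition that the dimension is 0 makes the formula narrow at
     every tuple, not only at [w]. *)
  exists p, (Conj phi (rename psi (@rshift 1 p))), w; split.
  - move=> x y /sat_conj[xy]; rewrite sat_rename join_rshift psiP => y0.
    by exists (solset phi y); split=> //; exact: definable_over_solset.
  - by move=> i; apply: wA; exists i.
  - rewrite /solset /mkset sat_conj sat_rename join_rshift psiP.
    by move: Xa X0; rewrite XE.
move=> [n [phi [b [nar bA sab]]]]; apply: cl_dim_mono (nar _ _ sab).
by move=> _ [i _ <-].
Qed.

(** * Generic points, Existence and rank in a monster model *)

Section Monster.
Variable kappa : Type.
Hypothesis Mm : monster kappa M.

Let kinf : infinite_set [set: kappa] := monster_infinite Mm.

(** Finitely many sets of dimension below 1 never cover a set of dimension 1, by (Dim 2). Removing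
    all those definable over [A] from the members of [F] therefore leaves a directed family of
    nonempty sets, to which saturation applies. *)
Lemma generic_point A (F : set (set ('I_1 -> M))) : small kappa A -> directed F ->
  (forall X, F X -> definable_over A X /\ dge 1 (D X)) ->
  exists2 a, (forall X, F X -> X (pt a)) & ~ cl A a.
Proof.
move=> sA [[X0 FX0] FI] FA; have [_ sat _] := Mm.
pose G := [set X `&` ~` Z | X in F & Z in [set Z | definable_over A Z /\ ~~ dge 1 (D Z)]].
have GP X Z : F X -> definable_over A Z -> ~~ dge 1 (D Z) -> G (X `&` ~` Z).
  by move=> FX AZ Z0; exists X => //; exists Z.
have d0 : ~~ dge 1 (D (set0 : set ('I_1 -> M))) by rewrite dim_set0.
have [||x xG] := saturated_directed kinf sat sA (F := G).
- split; first by exists (X0 `&` ~` set0); apply: GP => //; exact: definable_over0.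
  move=> _ _ [X FX [Z [AZ Z0] <-]] [Y FY [Z' [AZ' Z'0] <-]].
  have [T FT TXY] := FI _ _ FX FY.
  exists (T `&` ~` (Z `|` Z')).
    apply: GP => //; first exact: definable_overU.
    rewrite (dim2 dd);
      [|exact: definable_over_definable AZ|exact: definable_over_definable AZ'].
    by rewrite dge_dmax negb_or Z0.
  by move=> x [/TXY[Xx Yx] /not_orP[nZ nZ']].
- move=> _ [X FX [Z [AZ Z0] <-]]; have [AX X1] := FA _ FX; split.
    exact: definable_overI (definable_overC AZ).
  apply/set0P/eqP => XZ; have /negP[] := Z0; apply: dim_sub X1 => //.
  + exact: definable_over_definable AX.
  + exact: definable_over_definable AZ.
  + exact/subsets_disjoint.
exists (x ord0).
  move=> X FX; rewrite pt_ord0; have [|//] := xG (X `&` ~` set0).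
  by apply: GP => //; exact: definable_over0.
move=> /cl_dimP[Z [AZ Z0]]; rewrite pt_ord0;
  have [_] := xG (X0 `&` ~` Z) (GP _ _ FX0 AZ Z0).
exact.
Qed.

Lemma cl_dim_existence : existence kappa cl.
Proof.
move=> a B C sB sC nBa.
(* This is the type of [a] over [B]; each member has dimension at least 1 because [a] is not in
   [cl B]. *)
pose F := [set X : set ('I_1 -> M) | definable_over B X /\ X (pt a)].
have [|X [BX Xa]|a' aa' na'] := @generic_point (B `|` C) F (smallU kinf sB sC).
- split; first by exists setT; split=> //; exact: definable_overT.
  by move=> X Y [BX Xa] [BY Ya]; exists (X `&` Y) => //; split=> //;
    exact: definable_overI.
- split; first by apply: definable_over_sub BX; exact: subsetUl.
  by apply: contrapT => /negP X0; apply: nBa; apply/cl_dimP; exists X.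
exists a'; split=> // th thB; have Bth : definable_over B (psol th) by exists th.
split=> [tha|tha']; first by apply: aa'; split.
apply: contrapT => ntha; have : (~` psol th) (pt a'); last exact.
by apply: aa'; split=> //; exact: definable_overC.
Qed.

Lemma cl_dim_nontrivial : exists a, ~ cl set0 a.
Proof.
have [|X ->|a _ na] := @generic_point set0 [set setT] (small_finite kinf (finite_set0 _)).
- by split; [exists setT|move=> X Y -> ->; exists setT; rewrite ?setIT].
- by rewrite (dim1_line dd); split=> //; exact: definable_overT.
by exists a.
Qed.

Lemma cl_dim_existential : existential_matroid kappa cl.
Proof.
split; [exact: cl_dim_matroid|exact: cl_dim_definable|exact: cl_dim_existence|].
by move=> triv; have [a] := cl_dim_nontrivial; rewrite triv; apply.
Qed.

Lemma dim_over_cl_line A (X : set ('I_1 -> M)) : small kappa A -> definable_over A X ->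
  D X = dim_over cl A X.
Proof.
move=> sA AX; have dX := definable_over_definable AX.
have [X0|/eqP/set0P Xn0] := pselect (X = set0).
  by rewrite ((dim1_empty dd dX).2 X0) ((dim_over_empty cl X A).2 X0).
have [D0|D1] := dim_line dd dX Xn0.
  rewrite D0; apply/esym/(dim_over_line0 cl_dim_matroid); split=> // t Xt.
  by exists X.
have [|Y ->|a aX na] := @generic_point A [set X] sA.
- by split; [exists X|move=> Y Z -> ->; exists X; rewrite ?setIid].
- by rewrite D1.
rewrite D1; apply/esym/dge_Some; split.
  by apply/(dge_dim_over_line cl_dim_matroid); exists a; [exact: aX|rewrite asboolT].
by apply/negP => /(dge_dim_over_line cl_dim_matroid)[t _]; case: `[< _ >].
Qed.

Lemma dim_over_cl A m (V : set ('I_m -> M)) : small kappa A -> definable_over A V ->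
  dim_over cl A V = D V.
Proof.
move=> sA; elim: m V => [|m IH].
  move=> V AV; have dV := definable_over_definable AV.
  rewrite dim_over_point.
  case: asboolP => [V0|/eqP/set0P[x Vx]]; first by rewrite ((dim1_empty dd dV).2 V0).
  rewrite -(dim_point0 dd); congr (D _); apply/seteqP; split=> // y _.
  by rewrite (pt0_unique y x).
rewrite -addn1 => V AV; have dV := definable_over_definable AV.
rewrite (dim_over_fibration kinf cl_dim_matroid dim_over_cl_line sA AV).
by rewrite (dim_fibration dd) // !IH //; exact: dim4_definable.
Qed.

Lemma dim_cl_dim m (V : set ('I_m -> M)) : definable V -> dim_cl kappa cl V = D V.
Proof. by move=> /(dim_clP cl kinf)[A [sA AV ->]]; exact: dim_over_cl. Qed.

Lemma cl_dim_definable_dimension : definable_dimension kappa cl.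
Proof.
move=> m n X e /definable_overP[p [w [_ [phi XE]]]].
pose l := join (join (@rshift n (m + p) \o @lshift m p) (@lshift n (m + p)))
               (@rshift n (m + p) \o @rshift m p).
have XaE a : fiber X a = solset (rename phi l) (join a w).
  apply: funext => x; apply/propext;
    rewrite /solset /mkset sat_rename XE /fiber /mkset.
  by rewrite /l !join_comp !compA !join_rshift !join_lshift.
apply/definable_overP; exists p, w; split=> //.
(* The formulas for dimension values are built here from [D] itself, with [M] as the base
   structure. *)
exists (dim_val_formula dd (rename phi l) e); apply: funext => a; apply/propext.
rewrite /mkset sat_dim_val_formula -XaE dim_cl_dim // XaE; exact: definable_solset.
Qed.

End Monster.
End ClDim.

(** * The dimension function of an existential matroid *)

Section DimCl.
Variables (kappa : Type) (L : language) (M : structure L) (cl : set M -> set M).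
Hypotheses (Mm : monster kappa M) (em : existential_matroid kappa cl).

Let kinf : infinite_set [set: kappa] := monster_infinite Mm.
Let Msat : saturated kappa M. Proof. by case: Mm. Qed.
Let clm : is_matroid cl := em_matroid em.
Let D : dimfun M := @dim_cl kappa L M cl.

Let small_range n (b : 'I_n -> M) : small kappa (range b).
Proof. by apply: small_finite => //; exact: finite_image finite_finset. Qed.

(** Existence replaces a point of [X] outside [cl A'] by one of the same type over [A'], hence still
    in [X], that is also outside [cl B']. *)
Lemma dim_over_line_indep A B (X : set ('I_1 -> M)) : small kappa A -> small kappa B ->
  definable_over A X -> definable_over B X -> dim_over cl A X = dim_over cl B X.
Proof.
suff h A' B' k : small kappa A' -> small kappa B' -> definable_over A' X ->
    dge k (dim_over cl A' X) -> dge k (dim_over cl B' X).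
  by move=> sA sB AX BX; apply: dge_ext => k; apply/idP/idP; exact: h.
move=> sA sB [th [thA XE]] /(dge_dim_over_line clm)[t Xt kt].
apply/(dge_dim_over_line clm).
have [cAt|nAt] := pselect (cl A' t).
  by exists t => //; move: kt; rewrite asboolF // leqn0 => /eqP->.
have [t' [tt' nt']] := em_existence em sA sB nAt.
exists t'; first by rewrite XE; apply/(tt' th thA); rewrite -XE.
rewrite [X in _ <= nat_of_bool X]asboolT; first by apply: leq_trans kt _;
  case: `[< _ >].
by apply: contra_not nt'; apply: cl_monotone => // x; right.
Qed.

Lemma dim_cl_line A (X : set ('I_1 -> M)) : small kappa A -> definable_over A X ->
  D X = dim_over cl A X.
Proof.
move=> sA AX.
rewrite /D; have [B [sB BX ->]] := dim_clP cl kinf (definable_over_definable AX).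
exact: dim_over_line_indep.
Qed.

Lemma dim_cl_solset0 n (phi : formula L (1 + n)) (y : 'I_n -> M) :
  D (solset phi y) = Some 0 <->
  solset phi y !=set0 /\ forall t, solset phi y (pt t) -> cl (range y) t.
Proof.
by rewrite (dim_cl_line (small_range y) (definable_over_solset phi y)) dim_over_line0.
Qed.

Lemma narrow_disj n (phi psi : formula L (1 + n)) :
  narrow cl phi -> narrow cl psi -> narrow cl (Disj phi psi).
Proof. by move=> nphi npsi a b /sat_disj[/nphi|/npsi]. Qed.

Lemma narrow_fls n : narrow cl (Fls L (1 + n)).
Proof. by []. Qed.

(** Narrow formulas are closed under disjunction, so if none covered the set, saturation would give
    a point of it avoiding all of them at [y]. Definability of the matroid keeps such a point out of
    the closure of [y]. *)
Lemma narrow_cover n (phi : formula L (1 + n)) (y : 'I_n -> M) :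
  (forall t, solset phi y (pt t) -> cl (range y) t) ->
  exists2 psi : formula L (1 + n), narrow cl psi & solset phi y `<=` solset psi y.
Proof.
move=> phicl; apply: contrapT => no.
pose F := [set solset phi y `&` ~` solset psi y | psi in @narrow L M cl n].
have [||x xF] := saturated_directed kinf Msat (small_range y) (F := F).
- split; first by exists (solset phi y `&` ~` solset (Fls L (1 + n)) y);
    exists (Fls L (1 + n)).
  move=> _ _ [psi npsi <-] [psi' npsi' <-].
  exists (solset phi y `&` ~` solset (Disj psi psi') y).
    by exists (Disj psi psi') => //; exact: narrow_disj.
  move=> x [px nx]; split; split=> // h; apply: nx; apply/sat_disj; [left|right];
    exact: h.
- move=> _ [psi npsi <-]; split.
    apply: definable_overI; first exact: definable_over_solset.
    by apply: definable_overC; exact: definable_over_solset.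
  apply/set0P/eqP => /subsets_disjoint sub; apply: no; by exists psi.
have [phix _] := xF _ (ex_intro2 _ _ _ (@narrow_fls n) erefl).
move: (phix); rewrite -(pt_ord0 x) => /phicl; rewrite (em_definable em).
move=> [q [psi [b [npsi by_ psix]]]].
(* The tuple [b] only repeats entries of [y], so [psi] can be rewritten with [y] as its argument;
   monotonicity keeps it narrow. *)
have [|f bE] := @range_sub_comp _ _ _ b y; first by move=> _ [i _ <-]; exact: by_.
pose psi' := rename psi (join (@lshift 1 n) (@rshift 1 n \o f)).
have psiE t v : sat psi' (join (pt t) v) <-> sat psi (join (pt t) (v \o f)).
  by rewrite sat_rename join_comp compA join_lshift join_rshift.
have npsi' : narrow cl psi'.
  move=> a v /psiE /npsi; apply: cl_monotone => // _ [i _ <-]; by exists (f i).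
have [_] := xF _ (ex_intro2 _ _ _ npsi' erefl); apply.
rewrite -(pt_ord0 x); apply/psiE; move: psix; by rewrite bE.
Qed.

Lemma definable_over0_exists n (phi : formula L (1 + n)) :
  definable_over set0 [set y : 'I_n -> M | solset phi y !=set0].
Proof.
have := definable_over_exists (definable_over_solset0 M phi).
congr (definable_over _ _); apply: funext => y; apply/propext; split.
  by move=> [t]; rewrite /mkset join_lshift join_rshift => h; exists (pt t).
by move=> [x h]; exists (x ord0); rewrite /mkset join_lshift join_rshift pt_ord0.
Qed.

Lemma definable_over0_diff n (phi psi : formula L (1 + n)) :
  definable_over set0 [set y : 'I_n -> M | solset phi y `\` solset psi y !=set0].
Proof.
have := definable_over0_exists (Conj phi (Neg psi)).
congr (definable_over _ _); apply: funext => y; congr (_ !=set0).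
by apply: funext => x; apply/propext; exact: sat_conj.
Qed.

(** * Consequences of the definability of the dimension *)

Hypothesis ddim : definable_dimension kappa cl.

(* By compactness a single narrow psi witnesses "phi(M, y) is contained in
   cl(y)" for all such y at once; this gets rid of the parameters that the
   definability of the dimension allows. *)
Lemma dim_cl_zero_formula n (phi : formula L (1 + n)) :
  exists psi : formula L n, forall y : 'I_n -> M, sat psi y <-> D (solset phi y) = Some 0.
Proof.
pose W := [set y : 'I_n -> M | D (solset phi y) = Some 0].
(* The parameters [B] serve only the compactness argument, where they keep the family definable over
   a small set. *)
have [B [Bfin _ BW]] : exists B, [/\ finite_set B, B `<=` setT & definable_over B W].
  apply: definable_over_finite.
  have := ddim (Some 0) (definable_over_definable (definable_over_solset0 M phi)).
  by congr definable; apply: funext => y; rewrite /mkset -solsetE.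
have [psi npsi Wpsi] : exists2 psi : formula L (1 + n), narrow cl psi &
    forall y, W y -> solset phi y `<=` solset psi y.
  apply: contrapT => no.
  pose E psi := [set y : 'I_n -> M | solset phi y `\` solset psi y !=set0].
  have EP psi y : ~ E psi y <-> solset phi y `<=` solset psi y.
    split=> [nE x px|sub [x [/sub]]] //.
    by apply: contrapT => nx; apply: nE; exists x.
  pose F := [set W `&` E psi | psi in @narrow L M cl n].
  have [||y yF] := saturated_directed kinf Msat (small_finite kinf Bfin) (F := F).
  - split; first by exists (W `&` E (Fls L (1 + n))), (Fls L (1 + n)).
    move=> _ _ [psi npsi <-] [psi' npsi' <-].
    exists (W `&` E (Disj psi psi')); first by exists (Disj psi psi') => //;
      exact: narrow_disj.
    move=> y [Wy [x [px nx]]]; split; split=> //; exists x; split=> // h;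
      apply: nx; apply/sat_disj; [left|right]; exact: h.
  - move=> _ [psi npsi <-]; split.
      apply: definable_overI => //;
        apply: definable_over_sub (definable_over0_diff _ _).
      exact: sub0set.
    apply: contrapT => /set0P/negP/negPn/eqP WE; apply: no; exists psi => // y Wy.
    by apply/EP => Ey; have : (W `&` E psi) y by []; rewrite WE.
  have [Wy _] := yF _ (ex_intro2 _ _ _ (@narrow_fls n) erefl).
  have [_ /narrow_cover[psi npsi /EP nE]] := (dim_cl_solset0 _ _).1 Wy.
  by have [_ /nE] := yF _ (ex_intro2 _ _ _ npsi erefl).
(* The set [W] consists of the [y] for which [phi(M, y)] is nonempty and contained in [psi(M, y)], a
   condition free of parameters. *)
have := definable_overI (definable_over0_exists phi)
  (definable_overC (definable_over0_diff phi psi)).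
move=> /definable_over_empty[th thE]; exists th => y.
rewrite -[sat th y]/([set y | sat th y] y) -thE; split.
  move=> [ne nE]; apply/dim_cl_solset0; split=> // t phit.
  apply: npsi; apply: contrapT => npsit; by apply: nE; exists (pt t).
move=> Wy; have [ne _] := (dim_cl_solset0 _ _).1 Wy; split=> // -[x [px]].
by apply; exact: Wpsi Wy _ px.
Qed.

Lemma dim_cl_level_formula i n (phi : formula L (1 + n)) : i <= 1 ->
  exists psi : formula L n, forall y : 'I_n -> M, sat psi y <-> D (solset phi y) = Some i.
Proof.
have [psi psiP] := dim_cl_zero_formula phi.
case: i => [|[|//]] _; first by exists psi.
have [th thE] := (definable_over_empty _).1 (definable_over0_exists phi).
exists (Conj th (Neg psi)) => y.
rewrite sat_conj sat_neg psiP -[sat th y]/([set y | sat th y] y) -thE.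
rewrite /mkset (dim_cl_line (small_range y) (definable_over_solset phi y)).
split=> [[ne n0]|D1].
  apply/dge_Some; split.
    apply: contrapT => n1; apply: n0; apply/dge_Some; split; last exact/negP.
    have [x px] := ne; apply/(dge_dim_over_line clm).
    by exists (x ord0); rewrite ?pt_ord0.
  by apply/negP => /(dge_dim_over_line clm)[t _]; case: `[< _ >].
split; last by rewrite D1.
by apply/set0P/eqP => /(dim_over_empty cl _ (range y)); rewrite D1.
Qed.

Lemma dim_cl_level m (U : set ('I_(m + 1) -> M)) A i : definable_over A U -> i <= 1 ->
  definable_over A (level D U i).
Proof.
move=> AU i1; apply: level_definable_over AU => n phi; exact: dim_cl_level_formula.
Qed.

(** The level sets are formed with [D], hence without reference to [A] or [B], and are definable
    over each of them; the recursion thus reduces the claim to fewer coordinates. *)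
Lemma dim_over_indep A B m (V : set ('I_m -> M)) : small kappa A -> small kappa B ->
  definable_over A V -> definable_over B V -> dim_over cl A V = dim_over cl B V.
Proof.
move=> sA sB; elim: m V => [|m IH]; first by move=> V _ _; rewrite !dim_over_point.
rewrite -addn1 => V AV BV.
rewrite (dim_over_fibration kinf clm dim_cl_line sA AV).
rewrite (dim_over_fibration kinf clm dim_cl_line sB BV).
by rewrite !IH //; exact: dim_cl_level.
Qed.

Lemma dim_clE A m (V : set ('I_m -> M)) : small kappa A -> definable_over A V ->
  D V = dim_over cl A V.
Proof.
move=> sA AV.
rewrite /D; have [B [sB BV ->]] := dim_clP cl kinf (definable_over_definable AV).
exact: dim_over_indep.
Qed.

(** If [cl A] were everything, Existence over the empty set would leave no element outside
    [cl set0], and the matroid would be trivial. *)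
Lemma exists_notin_cl A : small kappa A -> exists a, ~ cl A a.
Proof.
move=> sA; apply: contrapT => /forallNP all_cl.
case: (em_nontrivial em) => X; apply/seteqP; split=> // a _; apply: contrapT => na.
have nset0 : ~ cl set0 a by apply: contra_not na; apply: cl_monotone => //;
  exact: sub0set.
have [a' [_]] := em_existence em (small_finite kinf (finite_set0 M)) sA nset0.
by rewrite set0U; exact: all_cl.
Qed.

Lemma dim_cl_dimension : is_dimension D.
Proof.
have sm m (V : set ('I_m -> M)) : definable V -> exists A, [/\ small kappa A,
    finite_set A & definable_over A V].
  move=> /definable_over_finite[A [Afin _ AV]]; exists A; split=> //.
  exact: small_finite.
split.
- move=> m S /sm[A [sA _ AS]]; rewrite (dim_clE sA AS); exact: dim_over_empty.
- move=> a; have sa : small kappa [set a] by apply: small_finite.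
  rewrite (dim_clE sa (definable_over_set1 (erefl a))).
  apply/(dim_over_line0 clm); split; first by exists (pt a).
  by move=> t /(congr1 (@^~ ord0)) e; apply: cl_extensive.
- have s0 : small kappa (set0 : set M) by apply: small_finite.
  rewrite (dim_clE s0 (definable_overT _ _)); apply/dge_Some; split.
    apply/(dge_dim_over_line clm); have [a na] := exists_notin_cl s0.
    by exists a; rewrite ?asboolT.
  by apply/negP => /(dge_dim_over_line clm)[t _]; case: `[< _ >].
- move=> m S T /sm[A [sA Afin AS]] /sm[B [sB Bfin BT]].
  have sAB : small kappa (A `|` B) by apply: small_finite => //; rewrite finite_setU.
  have AS' : definable_over (A `|` B) S by apply: definable_over_sub AS;
    exact: subsetUl.
  have BT' : definable_over (A `|` B) T by apply: definable_over_sub BT;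
    exact: subsetUr.
  rewrite (dim_clE sAB AS') (dim_clE sAB BT') (dim_clE sAB (definable_overU AS' BT')).
  exact: dim_overU.
- move=> m S s /sm[A [sA _ AS]].
  have AS' : definable_over A [set x \o s | x in S].
    have -> : [set x \o s | x in S] = [set x : 'I_m -> M | S (x \o (s^-1)%g)].
      apply/seteqP; split=> x.
        by move=> [y Sy <-] /=; congr S : Sy; apply: funext => i; rewrite /= permKV.
      by move=> Sx; exists (x \o (s^-1)%g) => //; apply: funext => i;
        rewrite /= permK.
    exact: definable_over_preimage.
  by rewrite (dim_clE sA AS) (dim_clE sA AS') dim_over_perm.
- by move=> m U A i; exact: dim_cl_level.
- move=> m U i /sm[A [sA _ AU]] i1.
  have AW : definable_over A (U `&` [set z | level D U i (proj z)]).
    apply: definable_overI => //.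
    exact: (definable_over_preimage (@lshift m 1) (dim_cl_level AU i1)).
  have D0 : D (set0 : set ('I_1 -> M)) = None.
    rewrite (dim_clE sA (definable_over0 _ _)); exact/dim_over_empty.
  (* Restricting [U] to the fibers of dimension [i] leaves a single nonempty level at most, so the
     maximum in the recursion reduces to one term. *)
  have lev k : level D (U `&` [set z | level D U i (proj z)]) k =
               if k == i then level D U i else set0.
    have fib x : fiber (U `&` [set z | level D U i (proj z)]) x =
                 if `[< level D U i x >] then fiber U x else set0.
      by case: asboolP => lx; apply/seteqP; split=> t;
        rewrite /fiber /= ?proj_join // => -[].
    apply/seteqP; split=> x; rewrite /level /mkset fib.
      case: asboolP => [lx|_]; last by rewrite D0.
      by rewrite lx => -[<-]; rewrite eqxx.
    by case: eqP => [->|//] lx; rewrite asboolT.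
  rewrite (dim_clE sA AW) (dim_over_fibration kinf clm dim_cl_line sA AW) !lev.
  have e0 : dim_over cl A (set0 : set ('I_m -> M)) = None by apply/dim_over_empty.
  have AL := dim_cl_level AU i1.
  case: i i1 AL {AW lev} => [|[|//]] _ AL /=; rewrite (dim_clE sA AL) e0.
    by case: (dim_over _ _ _) => //= k; rewrite addn0.
  by case: (dim_over _ _ _).
Qed.

Lemma cl_dim_dim_cl A : cl_dim D A = cl A.
Proof.
apply/seteqP; split=> a.
  move=> [X [/definable_over_finite[B [Bfin BA BX]] X0 Xa]].
  move: X0; rewrite (dim_clE (small_finite kinf Bfin) BX) => /(dim_over_line0 clm)[_ h].
  exact: cl_monotone BA _ (h _ Xa).
rewrite (em_definable em) => -[n [phi [b [nar bA phia]]]].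
exists (solset phi b); split=> //.
  by apply: definable_over_sub (definable_over_solset phi b) => _ [i _ <-].
apply/dim_cl_solset0; split; first by exists (pt a).
by move=> t; exact: nar.
Qed.

End DimCl.

Theorem theorem4p3 (kappa : Type) (L : language) :
  (forall (K M : structure L) (d : dimfun K) (j : K -> M),
     is_dimension d -> elementary j -> monster kappa M ->
     existential_matroid kappa (cl_dim (@dim_ext L K M d)) /\
     definable_dimension kappa (cl_dim (@dim_ext L K M d)) /\
     (forall m (V : set ('I_m -> M)), definable V ->
        dim_cl kappa (cl_dim (@dim_ext L K M d)) V = dim_ext M d V))
  /\
  (forall (M : structure L) (cl : set M -> set M),
     monster kappa M -> existential_matroid kappa cl ->
     definable_dimension kappa cl ->
     is_dimension (@dim_cl kappa L M cl) /\
     (forall A : set M, cl_dim (@dim_cl kappa L M cl) A = cl A)).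
Proof.
split=> [K M d j dd jel Mm|M cl Mm em ddim].
  have Dd := dim_ext_dimension dd jel.
  split; first exact: cl_dim_existential.
  split; first exact: cl_dim_definable_dimension.
  by move=> m V; exact: dim_cl_dim.
split; first exact: dim_cl_dimension.
exact: cl_dim_dim_cl.
Qed.
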